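(* Let $L$ be a Rosenthal compact set. Then $(C(L),\tau_p)$ is universally measurable.
   Context: $C(L)$ is the space of continuous (real- or complex-valued) functions on $L$ and $\tau_p$ is the topology of pointwise convergence on $L$. A compact Hausdorff space $L$ is a Rosenthal compact set if there is a Polish space $P$ such that $L$ is homeomorphic to a subspace of $(B_1(P),\tau_p)$, where $B_1(P)$ is the space of functions of the first Baire class on $P$ with the topology of pointwise convergence. A completely regular Hausdorff space $X$ is universally measurable if it is $\lambda$-measurable in its Stone–Čech compactification $\beta X$ for every finite Radon measure $\lambda$ on $\beta X$; equivalently, every normal Borel probability measure $\nu$ on $X$ (i.e. $\nu(\bigcup O_\alpha)=\lim\nu(O_\alpha)$ for every increasing net of open sets) is a Radon measure. *)

(* Defs.v *)
From HB Require Import structures.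
From mathcomp Require Import all_boot all_order all_algebra.
From mathcomp Require Import all_classical all_reals all_analysis.
From mathcomp Require Import measurable_realfun complex.

Set Implicit Arguments.
Unset Strict Implicit.
Unset Printing Implicit Defensive.
Import Order.TTheory GRing.Theory Num.Theory.
Import numFieldNormedType.Exports.

Local Open Scope classical_set_scope.
Local Open Scope ring_scope.

Definition homeomorphic (X Y : topologicalType) : Prop :=
  exists (f : X -> Y) (g : Y -> X),
    [/\ continuous f, continuous g, cancel f g & cancel g f].

(* The library's complete spaces are pointed, so completeness is spelled out in
   order to allow the empty space. *)
Definition polish (R : realType) (P : topologicalType) : Prop :=
  exists M : metricType R,
    [/\ homeomorphic P M,
        forall F : set_system M,
          ProperFilter F -> cauchy F -> exists p : M, F --> p
      & exists2 S : set M, countable S & dense S].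

Definition baire1 (R : realType) (P : topologicalType) : set {ptws P -> R} :=
  [set f | exists2 g : nat -> P -> R, (forall n, continuous (g n)) &
    forall x, g n x @[n --> \oo] --> (f x : R)].

(* A set coerces to the corresponding subtype, with the subspace topology. *)
Definition rosenthal_compact (R : realType) (L : topologicalType) : Prop :=
  [/\ compact [set: L], hausdorff_space L &
   exists P : topologicalType, polish R P /\
     exists2 A : set {ptws P -> R}, A `<=` @baire1 R P & homeomorphic L A].

Section Cp.
Variables (K : numFieldType) (L : topologicalType).

Definition continuous_fun : set {ptws L -> K} :=
  [set f | continuous (f : L -> K)].

Definition Cp : Type := continuous_fun.

HB.instance Definition _ := Topological.copy Cp (set_type continuous_fun).

Lemma continuous_fun0 : (fun=> 0) \in continuous_fun.
Proof. by apply/mem_set => x; exact: cvg_cst. Qed.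

(* Measurable types are required to be pointed. *)
HB.instance Definition _ :=
  isPointed.Build Cp (exist (fun f => f \in continuous_fun) _ continuous_fun0).

End Cp.

Section stone_cech.
Variables (R : realType) (X : ptopologicalType).

Definition unit_interval_fun : set (X -> R) :=
  [set f : X -> R | continuous f /\ forall x, 0 <= f x <= 1].

Definition stone_cech_eval (x : X) : {ptws unit_interval_fun -> R} :=
  fun f => set_val f x.

(* The closure of the image of X in the cube [0, 1]^C(X, [0, 1]); the cube is
   closed in the product of copies of R used here. *)
Definition stone_cech : Type := closure (range stone_cech_eval).

HB.instance Definition _ :=
  Topological.copy stone_cech (set_type (closure (range stone_cech_eval))).

Lemma stone_cech_evalP (x : X) :
  stone_cech_eval x \in closure (range stone_cech_eval).
Proof. by apply/mem_set/subset_closure; exists x. Qed.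

Definition stone_cech_unit (x : X) : stone_cech :=
  exist (fun p => p \in closure (range stone_cech_eval)) _ (stone_cech_evalP x).

HB.instance Definition _ := isPointed.Build stone_cech (stone_cech_unit point).

End stone_cech.

Notation borelType X := (g_sigma_algebraType (@open X)).

(* Inner regularity with respect to compact sets, for a finite Borel measure
   on a Hausdorff space. *)
Definition radon (R : realType) (X : ptopologicalType)
    (mu : {finite_measure set (borelType X) -> \bar R}) : Prop :=
  forall A : set (borelType X), measurable A ->
    mu A = ereal_sup
      [set mu C | C in [set C : set X | compact C /\ C `<=` A]].

(* [completed_algebra_gen lambda] consists of the sets B `|` N with B Borel and
   N contained in a Borel lambda-null set, i.e. of the lambda-measurable sets. *)
Definition universally_measurable (R : realType) (X : ptopologicalType) : Prop :=
  [/\ completely_regular_space X, hausdorff_space X &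
   forall lambda : {finite_measure set (borelType (stone_cech R X)) -> \bar R},
     radon lambda ->
     completed_algebra_gen lambda (range (@stone_cech_unit R X))].

(* Main.v *)
Require Import Defs.
From HB Require Import structures.
From mathcomp Require Import all_boot all_order all_algebra.
From mathcomp Require Import all_classical all_reals all_analysis.
From mathcomp Require Import complex.
From mathcomp Require Import lra.
Set Implicit Arguments.
Unset Strict Implicit.
Unset Printing Implicit Defensive.
Import Order.TTheory GRing.Theory Num.Theory.
Import numFieldNormedType.Exports.
Local Open Scope classical_set_scope.
Local Open Scope ring_scope.

(** Let X be C_p(L) and let lambda be a finite Radon measure on its Stone-Cech
compactification. Put m(A) = lambda^*(A) for A contained in X. Closed subsets
of X are m-measurable, and a union of m-null open sets is m-null because lambda
is Radon ([trace_outer_tau]). If m is tight, then X is, up to a lambda-null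
set, a countable union of compact sets, hence lambda-measurable
([universally_measurable_of_tight]). Everything therefore rests on tightness.

Tightness ([Cp_tight]) follows from the continuity of the map from L to L^0(m)
that sends x to the evaluation f |-> f x. Indeed, identify x and y when
f x = f y for m-almost all f. By continuity the quotient of L is compact, and
it is metrizable by convergence in measure. By the property of null open sets,
m-almost every f is constant on the classes. So m lives on the continuous
functions on a metrizable compact space; for the sup norm they form a complete
separable space whose balls are closed for pointwise convergence, and Ulam's
argument applies.

The continuity ([continuous_in_measure]) is where L, as a subset of B_1(P) with
P Polish, matters. If it fails at x0, there are eps > 0 and an ultrafilter F on
L that tends to x0 such that B x = {f : eps <= |f x - f x0|} has measure at
least eps for F-many x. Call a set A of functions null when m (B x & A) tends
to 0 along F; the null sets form a sigma-ideal, and X is not null.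

By compactness, each f is described up to eps / 8 by a finite tuple of points
of P and by a code taken from a countable set ([coded_ex]). So one code is
shared by a set of functions that is not null, and the tuples of these
functions have a support W, closed in a finite power of P: the functions whose
tuple lies in a given box around a point of W do not form a null set. Pick a
function u_j in each basic box that meets W. Then pick points x_n, tending to
x0 on u_0, u_1, ..., such that for every infinite set J all functions outside a
null set belong to B (x_n) for some n in J ([filter_selection]). This allows to
pick v_j in the same boxes, so that for each j infinitely many of the sets B
(x_n) contain v_0, ..., v_j ([branch_selection]). A cluster point y of suitable
x_n then satisfies |u_j y - u_j x0| <= eps / 2 and |v_j y - v_j x0| >= eps for
all j. But y and x0 are functions of the first Baire class on P. Read on W
through the coordinates, they have small oscillation on some box
([baire1_small_osc]), and there u_j and v_j nearly agree at y and at x0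
([coded_close]): a contradiction. *)

(** * Compactness and Baire category *)

(** The finite subcover argument for a property that survives the refinement of
    its data: otherwise the sets where it fails for [d] generate a proper
    filter, which has no cluster point. *)
Lemma compact_directed (X : topologicalType) (D : Type) (d0 : D)
    (join : D -> D -> D) (P : D -> X -> Prop) :
  compact [set: X] ->
  (forall d d' x, P d x \/ P d' x -> P (join d d') x) ->
  (forall x : X, exists d, \forall y \near x, P d y) ->
  exists d, forall x, P d x.
Proof.
move=> cX joinP nP; apply: contrapT => noP.
pose F : set_system X := [set A | exists d, forall x, ~ P d x -> A x].
have FF : ProperFilter F.
  split.
    by move=> [d dP]; apply: noP; exists d => x; apply: contrapT => /dP.
  split=> [|A B [d dA] [d' d'B]|A B AB [d dA]].
  - by exists d0.
  - by exists (join d d') => x nx; split; [apply: dA|apply: d'B] => dx;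
      apply/nx/joinP; [left|right].
  - by exists d => x /dA /AB.
have [x [_ Fx]] : [set: X] `&` cluster F !=set0 by apply: cX; exact: filterT.
have [d Pd] := nP x.
have Fd : F [set y | ~ P d y] by exists d.
by have [y [/= + ?]] := Fx _ _ Fd Pd.
Qed.

Section boxes.
Variables (R : realType) (M : metricType R).

(** Boxes of the power M^k. Its points are written as sequences, of which the
    first k entries are read, so that k need not appear in types. *)
Definition box (k : nat) (w : nat -> M) (r : R) : set (nat -> M) :=
  [set v | forall i, (i < k)%N -> ball (w i) r (v i)].

Definition box_closed k (W : set (nat -> M)) :=
  forall w, (forall r, 0 < r -> exists2 v, W v & box k w r v) -> W w.

Lemma box_refl k w r : 0 < r -> box k w r w.
Proof. by move=> r0 i _; exact: ballxx. Qed.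

Lemma box_sym k w v r : box k w r v -> box k v r w.
Proof. by move=> wv i /wv; exact: ball_sym. Qed.

Lemma box_trans k w v r s : box k w r v -> box k v s `<=` box k w (r + s).
Proof. by move=> wv u vu i ik; apply: ball_triangle (wv i ik) (vu i ik). Qed.

Lemma le_box k w r s : r <= s -> box k w r `<=` box k w s.
Proof. by move=> rs v wv i /wv; exact: le_ball. Qed.

Lemma box_half k w v r : box k w (r / 2) v -> box k v (r / 2) `<=` box k w r.
Proof. by rewrite {3}(splitr r); exact: box_trans. Qed.

Lemma box_open k w v r : box k w r v ->
  exists2 s, 0 < s & box k v s `<=` box k w r.
Proof.
elim: k => [|k IH] wv; first by exists 1.
have [|s s0 vs] := IH; first by move=> i ik; exact/wv/ltnW.
have rk : 0 < r - mdist (w k) (v k).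
  by rewrite subr_gt0; have := wv k (leqnn _); rewrite ballEmdist.
exists (Num.min s (r - mdist (w k) (v k))); first by rewrite lt_min s0.
move=> u vu i; rewrite ltnS leq_eqVlt => /predU1P[->|ik].
  have := vu k (leqnn _); rewrite !ballEmdist/= lt_min => /andP[_ vuk].
  by rewrite (le_lt_trans (metric_triangle _ (v k) _))// -ltrBrDl.
apply: vs ik => j jk; apply: le_ball (vu j (ltnW jk)).
by rewrite ge_min lexx.
Qed.

Hypothesis cM : forall F : set_system M,
  ProperFilter F -> cauchy F -> exists p : M, F --> p.

(** Baire's theorem in the style of the Banach-Mazur game: nested boxes avoid
    the sets [A n] one after the other, and completeness provides a common
    point. *)
Lemma box_baire k (W : set (nat -> M)) (A : nat -> set (nat -> M)) w0 r0 :
  box_closed k W -> W w0 -> 0 < r0 ->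
  (forall n w r, W w -> 0 < r -> box k w r `<=` box k w0 r0 ->
    exists v s, [/\ W v, 0 < s, box k v s `<=` box k w r &
      forall u, W u -> box k v s u -> ~ A n u]) ->
  exists w, [/\ W w, box k w0 r0 w & forall n, ~ A n w].
Proof.
move=> clW Ww0 r00 step.
pose adm (p : (nat -> M) * R) :=
  [/\ W p.1, 0 < p.2 & box k p.1 p.2 `<=` box k w0 r0].
(* The limit lies in the closure of each box only. Requiring that the doubled
   box be contained in the previous one makes it a point of the boxes. *)
pose nxt n (p q : (nat -> M) * R) := adm p -> [/\ adm q, q.2 <= n.+1%:R^-1,
  box k q.1 (q.2 + q.2) `<=` box k p.1 p.2 &
  forall u, W u -> box k q.1 (q.2 + q.2) u -> ~ A n u].
have ex_nxt n p : exists q, nxt n p q.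
  have [[Wp p0 pw]|] := pselect (adm p); last by exists p.
  have [v [s [Wv s0 vs vA]]] := step n p.1 p.2 Wp p0 pw.
  pose t := Num.min (s / 2) n.+1%:R^-1.
  have ts : t + t <= s by rewrite [leRHS]splitr lerD// ge_min lexx.
  have t0 : 0 < t by rewrite lt_min divr_gt0//= invr_gt0.
  exists (v, t) => _; split => /=.
  - split => //=; apply: subset_trans pw; apply: subset_trans vs.
    by apply: le_box; lra.
  - by rewrite ge_min lexx orbT.
  - by apply: subset_trans vs; exact: le_box.
  - by move=> u Wu vu; apply: vA => //; exact: le_box vu.
have [f fP] := choice (fun np => ex_nxt np.1 np.2).
pose s := fix s n := if n is m.+1 then f (m, s m) else (w0, r0 / 2).
have adms n : adm (s n).
  elim: n => [|n IH] /=.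
    by split => //=; [exact: divr_gt0|apply: le_box; lra].
  by have [] := fP (n, s n) IH.
have sS n := fP (n, s n) (adms n).
have s_mon n m : (n <= m)%N -> box k (s m).1 (s m).2 `<=` box k (s n).1 (s n).2.
  move=> /subnK <-; elim: (m - n)%N => [//|l IH].
  have [[_ p0 _] _ + _] := sS (l + n)%N; move=> /(subset_trans _) sub.
  apply: subset_trans IH; apply: sub; rewrite /=.
  by apply: le_box; rewrite lerDl ltW.
have sin n m : (n <= m)%N -> box k (s n).1 (s n).2 (s m).1.
  by move=> nm; apply: (s_mon _ _ nm); apply: box_refl; have [] := adms m.
have s_small e : 0 < e -> exists n, (s n).2 < e.
  move=> e0; have [N _ HN] := near_infty_natSinv_lt (PosNum e0).
  exists N.+1; have [_ /le_lt_trans + _ _] := sS N; apply.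
  exact: (HN N (leqnn N)).
have lim_ex i : exists l : M, (i < k)%N -> (s n).1 i @[n --> \oo] --> l.
  case: (ltnP i k) => ik; last by exists (w0 i).
  have FF : ProperFilter ((fun n => (s n).1 i) @ \oo).
    exact: fmap_proper_filter.
  have [|l sl] := cM FF; last by exists l.
  apply: cauchy_exP => e e0; have [n ne] := s_small e e0.
  exists ((s n).1 i); exists n => // m nm /=.
  by apply: (le_ball (ltW ne)); exact: sin.
have [w wP] := choice lim_ex.
have win n : box k (s n).1 ((s n).2 + (s n).2) w.
  move=> i ik; have p0 : 0 < (s n).2 by have [] := adms n.
  have /cvg_ballP/(_ _ p0)[m _ Hm] := wP i ik.
  have /= /ball_sym := Hm (maxn n m) (leq_maxr _ _).
  by apply: ball_triangle; apply: sin => //; exact: leq_maxl.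
exists w; split => [|| n].
- apply: clW => r r0'; have r20 : 0 < r / 2 by exact: divr_gt0.
  have [n nr] := s_small _ r20.
  exists (s n).1; first by have [] := adms n.
  by apply/box_sym; apply: le_box (win n); lra.
- by have := win 0%N; rewrite /= -splitr.
- have [_ _ _] := sS n; apply; last exact: (win n.+1).
  apply: clW => r r0'; have r20 : 0 < r / 2 by exact: divr_gt0.
  have [m mr] := s_small _ r20.
  exists (s m).1; first by have [] := adms m.
  by apply/box_sym; apply: le_box (win m); lra.
Qed.

(** The consequence of the point of continuity property that is inherited by
    finite families, by shrinking the box once for each function. *)
Definition small_osc k (W : set (nat -> M)) (f : (nat -> M) -> R) :=
  forall w r e, W w -> 0 < r -> 0 < e -> exists v s,
    [/\ W v, 0 < s, box k v s `<=` box k w r &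
     forall u u', W u -> W u' -> box k v s u -> box k v s u' ->
       `|f u - f u'| < e].

(** Let f be the limit of the continuous functions g n, and let [A n] be the
    closed set where g m stays within e / 4 of g n for all m >= n. If the part
    of W in some box lies in [A n], then the continuity of g n makes the
    oscillation of f small. Otherwise Baire's theorem gives a point of W outside
    all the [A n], where g does not converge. *)
Lemma baire1_small_osc k W (f : M -> R) i : box_closed k W ->
  @baire1 R M f -> (i < k)%N -> small_osc k W (fun w => f (w i)).
Proof.
move=> clW [g gc gf] ik w0 r0 e Ww0 r00 e0; apply: contrapT => nosc.
have e40 : 0 < e / 4 by lra.
pose A n : set (nat -> M) := [set w | forall m, (n <= m)%N ->
  `|g m (w i) - g n (w i)| <= e / 4].
have [|w [_ _ wA]] := @box_baire k W A w0 r0 clW Ww0 r00.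
  move=> n w r Ww r0' wr; apply: contrapT => nv; apply: nosc.
  have key v : W v -> box k w r v -> A n v.
    move=> Wv wv m nm; rewrite leNgt; apply/negP => gmn; apply: nv.
    have cg : `|g m x - g n x| @[x --> v i] --> `|g m (v i) - g n (v i)|.
      by apply: cvg_norm; apply: cvgB; exact: gc.
    have [s /= s0 sP] := (nbhs_ballP _ _).1 (cvgr_gt _ cg _ gmn).
    exists v.
    have [t t0 vt] := box_open wv.
    exists (Num.min s t); split => //.
    - by rewrite lt_min s0 t0.
    - by apply: subset_trans vt; apply: le_box; rewrite ge_min lexx orbT.
    - move=> u Wu vu /(_ m nm); apply/negP; rewrite -ltNge; apply: sP.
      by apply: le_ball (vu i ik); rewrite ge_min lexx.
  have cg : {for w i, continuous (g n)} by exact: gc.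
  have /cvgrPdist_lt/(_ (e / 8))/= := cg.
  have e80 : 0 < e / 8 by lra.
  move=> /(_ e80) /nbhs_ballP[s /= s0 sP].
  exists w, (Num.min s r); split => //.
  - by rewrite lt_min s0.
  - by apply: subset_trans wr; apply: le_box; rewrite ge_min lexx orbT.
  move=> u u' Wu Wu' wu wu'.
  have fg v : W v -> box k w (Num.min s r) v -> `|f (v i) - g n (v i)| <= e / 4.
    move=> Wv wv; have vA : A n v.
      by apply: key => //; apply: le_box wv; rewrite ge_min lexx orbT.
    have : `|g m (v i) - g n (v i)| @[m --> \oo] --> `|f (v i) - g n (v i)|.
      by apply: cvg_norm; apply: cvgB; [exact: gf|exact: cvg_cst].
    apply: (closed_cvg (fun x : R => x <= e / 4)); first exact: closed_le.
    by exists n => // m /= nm; rewrite -normrN opprB vA.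
  have gw v : box k w (Num.min s r) v -> `|g n (w i) - g n (v i)| < e / 8.
    by move=> wv; apply: sP; apply: le_ball (wv i ik); rewrite ge_min lexx.
  have := fg u Wu wu; have := fg u' Wu' wu'; have := gw u wu; have := gw u' wu'.
  rewrite !ltr_norml !ler_norml; lra.
have e80 : 0 < e / 8 by lra.
have /cvgrPdist_lt/(_ _ e80) [n _ nP] := gf (w i).
apply: (wA n) => m nm /=.
have := nP n (leqnn n); have := nP m nm.
rewrite /= ltr_norml ler_norml ltr_norml.
by lra.
Qed.

Lemma small_osc_all k W (f : nat -> (nat -> M) -> R) n w r e :
  (forall i, (i < n)%N -> small_osc k W (f i)) ->
  W w -> 0 < r -> 0 < e -> exists v s,
    [/\ W v, 0 < s, box k v s `<=` box k w r &
     forall i, (i < n)%N -> forall u u', W u -> W u' ->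
       box k v s u -> box k v s u' -> `|f i u - f i u'| < e].
Proof.
move=> fo Ww r0 e0; elim: n fo => [|n IH] fo; first by exists w, r; split.
have [|v [s [Wv s0 vs vf]]] := IH; first by move=> i ni; apply: fo (leqW ni).
have [v' [s' [Wv' s'0 v's' v'f]]] := fo n (leqnn _) v s e Wv s0 e0.
exists v', s'; split => //; first exact: subset_trans vs.
move=> i; rewrite ltnS leq_eqVlt => /predU1P[->//|lt_in] u u' Wu Wu' vu vu'.
by apply: vf => //; exact: v's'.
Qed.

End boxes.

(** * Polish distances *)

(** The distance is real-valued also for V = R[i], where the norm takes its
    values in R[i]. *)
Record polish_dist (R : realType) (V : topologicalType)
    (d : V -> V -> R) : Prop := {
  dist_refl : forall x, d x x = 0;
  dist_sym : forall x y, d x y = d y x;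
  dist_tri : forall y x z, d x z <= d x y + d y z;
  dist_nbhs : forall x (U : set V),
    nbhs x U <-> exists2 e, 0 < e & [set y | d x y < e] `<=` U;
  dist_separable : exists s : nat -> V,
    forall x e, 0 < e -> exists n, d x (s n) < e;
  dist_complete : forall F : set_system V, ProperFilter F ->
    (forall e, 0 < e -> exists x, F [set y | d x y < e]) ->
    exists l : V, F --> l }.

Section polish_dist_theory.
Variables (R : realType) (V : topologicalType) (d : V -> V -> R).
Hypothesis dP : polish_dist d.

Lemma dist_cvgP (T : Type) (F : set_system T) {FF : Filter F} (f : T -> V) l :
  f x @[x --> F] --> l <-> forall e, 0 < e -> \forall x \near F, d l (f x) < e.
Proof.
split=> [fl e e0|fl U /(dist_nbhs dP)[e e0 eU]].
  by apply: (fl [set y | d l y < e]); apply/(dist_nbhs dP); exists e.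
by apply: filterS (fl e e0) => x xe; apply: eU.
Qed.

Lemma dist_cvg (T : Type) (F : set_system T) {FF : Filter F}
    (f g : T -> V) l m :
  f x @[x --> F] --> l -> g x @[x --> F] --> m ->
  d (f x) (g x) @[x --> F] --> d l m.
Proof.
move=> /dist_cvgP fl /dist_cvgP gm; apply/cvgrPdist_lt => e e0.
have e20 : 0 < e / 2 by exact: divr_gt0.
near=> x.
have lx : d l (f x) < e / 2 by near: x; exact: fl.
have mx : d m (g x) < e / 2 by near: x; exact: gm.
have := dist_tri dP (f x) l m; have := dist_tri dP (g x) (f x) m.
have := dist_tri dP l (f x) (g x); have := dist_tri dP m l (g x).
rewrite (dist_sym dP (f x) l) (dist_sym dP (g x) m) ltr_norml; lra.
Unshelve. all: by end_near. Qed.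

Lemma dist_continuous (T : topologicalType) (f g : T -> V) :
  continuous f -> continuous g -> continuous (fun x => d (f x) (g x)).
Proof. by move=> fc gc x; apply: dist_cvg; [exact: fc|exact: gc]. Qed.

End polish_dist_theory.

(** * Finite descriptions of continuous functions *)

Section coding.
Variables (R : realType) (V : topologicalType) (d : V -> V -> R).
Hypothesis dP : polish_dist d.
Variables (L : topologicalType) (M : metricType R) (e : L -> M -> R).
Hypothesis cL : compact [set: L].
Hypothesis e_cont : forall p, continuous (fun x => e x p).
Hypothesis e_inj : forall x y, (forall p, e x p = e y p) -> x = y.

(** Evaluations separate the points of the compact space L. So on L * L, either
    some evaluation separates the two points, or they are equal and f takes
    close values nearby. *)
Lemma uniformly_determined (f : L -> V) (eps : R) : continuous f -> 0 < eps ->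
  exists ps : seq M, exists n : nat, forall x y,
    (forall p, p \in ps -> `|e x p - e y p| < n.+1%:R^-1) ->
    d (f x) (f y) < eps.
Proof.
move=> fc eps0; pose P (c : seq M * nat) (z : L * L) :=
  (forall p, p \in c.1 -> `|e z.1 p - e z.2 p| < c.2.+1%:R^-1) ->
  d (f z.1) (f z.2) < eps.
have [] := @compact_directed (L * L)%type (seq M * nat)%type ([::], 0%N)
  (fun c c' => (c.1 ++ c'.1, maxn c.2 c'.2)) P.
- by rewrite -setXTT; exact: compact_setX.
- move=> [ps n] [qs m] z [] Pz H; apply: Pz => p /= pps.
    have := H p; rewrite mem_cat pps => /(_ isT) /lt_le_trans; apply => /=.
    by rewrite lef_pV2 ?posrE// ler_nat ltnS leq_maxl.
  have := H p; rewrite mem_cat pps orbT => /(_ isT) /lt_le_trans; apply => /=.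
  by rewrite lef_pV2 ?posrE// ler_nat ltnS leq_maxr.
- move=> [x y]; have [[p pxy]|] := pselect (exists p, e x p != e y p).
    have exy : 0 < `|e x p - e y p| / 2.
      by rewrite divr_gt0// normr_gt0 subr_eq0.
    have [n _ nP] := near_infty_natSinv_lt (PosNum exy).
    exists ([:: p], n).
    have cxy : `|e z.1 p - e z.2 p| @[z --> (x, y)] --> `|e x p - e y p|.
      apply: cvg_norm; apply: cvgB.
        apply: (cvg_comp (@fst L L) (fun u => e u p)); first exact: cvg_fst.
        exact: e_cont.
      apply: (cvg_comp (@snd L L) (fun u => e u p)); first exact: cvg_snd.
      exact: e_cont.
    have : `|e x p - e y p| / 2 < `|e x p - e y p| by move: (exy); lra.
    move=> /(cvgr_gt _ cxy); apply: filterS => z zxy /(_ p (mem_head _ _)) /=.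
    by move=> /lt_trans/(_ (nP n (leqnn n)))/lt_trans/(_ zxy); rewrite ltxx.
  move=> /forallNP exy; have <- : x = y.
    by apply: e_inj => p; apply/eqP/negPn/negP; exact: exy.
  exists ([::], 0%N).
  have cxy : d (f z.1) (f z.2) @[z --> (x, x)] --> d (f x) (f x).
    apply: (dist_cvg dP).
      by apply: (cvg_comp (@fst L L) f); [exact: cvg_fst|exact: fc].
    by apply: (cvg_comp (@snd L L) f); [exact: cvg_snd|exact: fc].
  rewrite (dist_refl dP) in cxy.
  by apply: filterS (cvgr_lt _ cxy _ eps0) => z zlt _; exact: zlt.
- by case=> ps n psn; exists ps, n => x y; exact: (psn (x, y)).
Qed.

Variable s : nat -> V.
Hypothesis sP : forall x e, 0 < e -> exists n, d x (s n) < e.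

Definition in_cell (k : nat) (x : L) (w : nat -> M) (a : seq rat) (r : R) :=
  forall i, (i < k)%N -> `|e x (w i) - ratr (nth 0 a i)| < r.

Definition code := (nat * nat * seq (seq rat * nat))%type.

(** A code is a table of values of f: the cells of radius 1 / (n + 1) around
    its rational vectors cover L, and f is nearly constant on the cells of twice
    that radius. There are countably many codes; the tuple [w] carries the part
    of the description that is not countable. *)
Definition coded (eps : R) (f : L -> V) (w : nat -> M) (c : code) :=
  let: (k, n, tab) := c in
  (forall x, exists2 row, row \in tab & in_cell k x w row.1 n.+1%:R^-1) /\
  (forall row x, row \in tab -> in_cell k x w row.1 (2 * n.+1%:R^-1) ->
    d (f x) (s row.2) < eps).

Lemma coded_ex (p0 : M) (eps : R) (f : L -> V) : 0 < eps -> continuous f ->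
  exists c w, coded eps f w c.
Proof.
move=> eps0 fc; have e20 : 0 < eps / 2 by exact: divr_gt0.
have [ps [m psm]] := uniformly_determined fc e20.
pose k := size ps; pose w := nth p0 ps.
(* Two points of a doubled cell differ by less than 4 / (n + 1) in each
   coordinate. *)
have [n n4] : exists n, 4 * n.+1%:R^-1 = m.+1%:R^-1 :> R.
  exists (4 * m + 3)%N; have -> : (4 * m + 3).+1 = (4 * m.+1)%N.
    by rewrite -addnS mulnS addnC.
  by rewrite natrM invfM mulrA mulfV ?mul1r// pnatr_eq0.
have [del delE] : exists del : R, del = n.+1%:R^-1 by eexists.
have n0 : 0 < del by rewrite delE invr_gt0.
rewrite -delE in n4.
have [||| tab tabP] := @compact_directed L (seq (seq rat)) [::] (@cat _)
  (fun tab x => exists2 a, a \in tab & in_cell k x w a del).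
- exact: cL.
- by move=> t t' x [] [a ta xa]; exists a => //; rewrite mem_cat ta ?orbT.
- move=> x.
  have rat_near i : exists q : rat, `|e x (w i) - ratr q| < del.
    have [|q] := @rat_in_itvoo R (e x (w i) - del) (e x (w i) + del).
      by lra.
    rewrite in_itv/= => /andP[q1 q2].
    by exists q; rewrite ltr_norml; apply/andP; split; lra.
  have [q qP] := choice rat_near.
  exists [:: mkseq q k].
  have H : \forall y \near x, forall i : 'I_k,
      `|e y (w i) - ratr (q i)| < del.
    apply: filter_forall => i.
    have cx : `|e y (w i) - ratr (q i)| @[y --> x] -->
        `|e x (w i) - ratr (q i)|.
      by apply: cvg_norm; apply: cvgB; [exact: e_cont|exact: cvg_cst].
    exact: (cvgr_lt _ cx _ (qP i)).
  apply: filterS H => y yP; exists (mkseq q k); first exact: mem_head.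
  by move=> i ik; rewrite nth_mkseq//; exact: (yP (Ordinal ik)).
have val a : exists r, forall x, in_cell k x w a (2 * del) ->
    d (f x) (s r) < eps.
  have [[x xa]|] := pselect (exists x, in_cell k x w a (2 * del)); last first.
    by move=> /forallNP na; exists 0%N => x /na.
  have [r rP] := sP (f x) e20; exists r => y ya.
  have yx : d (f y) (f x) < eps / 2.
    apply: psm => p /(nthP p0)[i ik <-]; rewrite -n4.
    have := xa i ik; have := ya i ik; rewrite !ltr_norml -/(w i); lra.
  by have := dist_tri dP (f x) (f y) (s r); lra.
have [r rP] := choice val.
exists (k, n, [seq (a, r a) | a <- tab]), w; rewrite /coded -delE; split.
  move=> x; have [a at_ xa] := tabP x.
  by exists (a, r a) => //; exact: map_f.
by move=> _ x /mapP[a _ ->]; exact: rP.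
Qed.

(** The cell in which y falls according to v contains y also according to w,
    after doubling: both functions follow the same entry of the table. *)
Lemma coded_close eps f g v w c y : coded eps f v c -> coded eps g w c ->
  (forall i, (i < c.1.1)%N -> `|e y (v i) - e y (w i)| < c.1.2.+1%:R^-1) ->
  d (f y) (g y) < 2 * eps.
Proof.
case: c => -[k n] tab /=.
have [del delE] : exists del : R, del = n.+1%:R^-1 by eexists.
have n0 : 0 < del by rewrite delE invr_gt0.
rewrite -delE => -[fA fB] [_ gB] vw.
have [row trow yrow] := fA y.
have := fB row y trow; have := gB row y trow.
have cell_w : in_cell k y w row.1 (2 * del).
  move=> i ik; have := yrow i ik; have := vw i ik; rewrite !ltr_norml; lra.
have cell_v : in_cell k y v row.1 (2 * del).
  by move=> i ik; have := yrow i ik; rewrite !ltr_norml; lra.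
move=> /(_ cell_w) gs /(_ cell_v) fs.
have := dist_tri dP (s row.2) (f y) (g y).
by rewrite (dist_sym dP (s _)); lra.
Qed.

End coding.

(** * Null sets along an ultrafilter *)

Definition infinitely_often (J : set nat) :=
  forall N, exists2 n, (N <= n)%N & J n.

Section filter_null_sets.
Variables (R : realType) (dT : measure_display) (T : measurableType dT).
Variables (mu : {measure set T -> \bar R}).
Hypothesis mufin : (mu setT < +oo)%E.

Lemma measure_decreasing_to0 (E : nat -> set T) (a : R) :
  (forall n, measurable (E n)) -> (forall n m, (n <= m)%N -> E m `<=` E n) ->
  \bigcap_n E n = set0 -> 0 < a ->
  exists N, forall n, (N <= n)%N -> (mu (E n) < a%:E)%E.
Proof.
move=> mE dE E0 a0.
have : mu (E n) @[n --> \oo] --> (0 : \bar R)%E.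
  rewrite -(measure0 mu) -E0; apply: nonincreasing_cvg_mu => //.
  - by apply: le_lt_trans mufin; apply: le_measure; rewrite ?inE.
  - by rewrite E0.
  - by move=> n m nm; apply/subsetPset/dE.
move=> /fine_cvgP[_ /cvgrPdist_lt/(_ _ a0)][N _ NP]; exists N => n Nn.
have := NP n Nn; rewrite /= sub0r normrN.
have fE : mu (E n) \is a fin_num.
  rewrite ge0_fin_numE//; apply: le_lt_trans mufin.
  by apply: le_measure; rewrite ?inE.
by rewrite ger0_norm ?fine_ge0// -lte_fin fineK.
Qed.

Variables (L : Type) (F : set_system L) (B : L -> set T).
Hypothesis FF : UltraFilter F.
Hypothesis mB : forall x, measurable (B x).

(** The null sets of the measure C |-> lim (mu (B x `&` C)) along F, which is
    dominated by mu. *)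
Definition filter_null (A : set T) := exists2 C, measurable C /\ A `<=` C &
  forall a : R, 0 < a -> \forall x \near F, (mu (B x `&` C) < a%:E)%E.

Lemma filter_null_sub A A' : A `<=` A' -> filter_null A' -> filter_null A.
Proof.
by move=> AA [C [mC A'C] HC]; exists C => //; split => // t /AA /A'C.
Qed.

Lemma filter_null0 : filter_null set0.
Proof.
exists set0; first by split.
move=> a a0; apply: nearW => x.
by rewrite setI0 measure0 lte_fin.
Qed.

(** Countable unions stay null because of the domination by mu: finitely many
    sets exhaust the union up to a set of small measure. *)
Lemma filter_null_bigcup (A : nat -> set T) : (forall n, filter_null (A n)) ->
  filter_null (\bigcup_n A n).
Proof.
move=> nA.
have /choice[C CP] : forall n, exists C, [/\ measurable C, A n `<=` C &
    forall a : R, 0 < a -> \forall x \near F, (mu (B x `&` C) < a%:E)%E].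
  by move=> n; have [C [? ?] ?] := nA n; exists C.
have mC n : measurable (C n) by have [] := CP n.
pose D m := \bigcup_(i < m) C i.
have mD m : measurable (D m) by exact: bigcup_measurable.
exists (\bigcup_n C n).
  split; first exact: bigcupT_measurable.
  by move=> t [n _ At]; exists n => //; have [_ + _] := CP n; exact.
have D_null m a : 0 < a -> \forall x \near F, (mu (B x `&` D m) < a%:E)%E.
  elim: m a => [|m IH] a a0.
    by apply: nearW => x; rewrite /D II0 bigcup0// setI0 measure0 lte_fin.
  have a20 : 0 < a / 2 by exact: divr_gt0.
  have [_ _ /(_ _ a20) Cm] := CP m.
  near=> x.
  have -> : B x `&` D m.+1 = (B x `&` D m) `|` (B x `&` C m).
    rewrite -setIUr; congr (_ `&` _); apply/seteqP; split => [t [i /= + Ci]|t].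
      by rewrite ltnS leq_eqVlt => /predU1P[<-|im]; [right|left; exists i].
    move=> [[i /= im Ci]|Cm']; last by exists m => //=.
    by exists i => //=; exact: leqW.
  apply: le_lt_trans (measureU2 _ _ _) _; try exact: measurableI.
  rewrite (splitr a) EFinD; apply: lteD; near: x; [exact: IH|exact: Cm].
move=> a a0; have a20 : 0 < a / 2 by exact: divr_gt0.
have mCD n : measurable (\bigcup_n C n `\` D n).
  by apply: measurableD => //; exact: bigcupT_measurable.
have [||N NP] := measure_decreasing_to0 mCD _ _ a20.
- move=> n m nm t [Ct nD]; split => // -[i /= im Ci]; apply: nD.
  by exists i => //=; exact: leq_trans im nm.
- rewrite -subset0 => t tE; have [[n _ Cn] _] := tE 0%N I.
  by have [_] := tE n.+1 I; apply; exists n => //=.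
apply: filterS (D_null N _ a20) => x xD.
apply: (@le_lt_trans _ _ (mu (B x `&` D N) + mu (\bigcup_n C n `\` D N))%E).
  apply: le_trans (measureU2 _ _ _); [|exact: measurableI|exact: mCD].
  apply: le_measure; rewrite ?inE.
  - by apply: measurableI => //; exact: bigcupT_measurable.
  - by apply: measurableU => //; exact: measurableI.
  - by move=> t [Bt Ct]; have [Dt|nDt] := pselect (D N t); [left|right].
by rewrite (splitr a) EFinD; apply: lteD => //; exact: NP.
Unshelve. all: by end_near. Qed.

Lemma filter_null_bigcup_count (I : countType) (A : I -> set T) :
  (forall i, filter_null (A i)) -> filter_null (\bigcup_i A i).
Proof.
move=> nA.
have := @filter_null_bigcup
  (fun n => if unpickle n is Some i then A i else set0).
move=> /(_ _)/filter_null_sub; apply; last first.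
  by move=> n; case: (unpickle n) => [i|]; [exact: nA|exact: filter_null0].
by move=> t [i _ Ai]; exists (pickle i) => //; rewrite pickleK.
Qed.

Lemma filter_nullU A A' :
  filter_null A -> filter_null A' -> filter_null (A `|` A').
Proof.
move=> nA nA'.
have := @filter_null_bigcup (fun n => if n is 0%N then A else A').
move=> /(_ _)/filter_null_sub; apply; last by case.
by move=> t [At|At]; [exists 0%N|exists 1%N].
Qed.

(** The point x_n is such that [B (x_ n)] takes its share of every set left by
    the previous ones: at least 1 / (k + 1), for k <= n, if the limit along F
    is that large. If the intersection over J were not null, then for some k
    all large n in J would remove 1 / (k + 1) from a decreasing sequence of sets
    of finite measure. *)
Lemma filter_selection (G : nat -> set L) : (forall n, F (G n)) ->
  exists x_ : nat -> L, (forall n, G n (x_ n)) /\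
    forall J, infinitely_often J -> filter_null (\bigcap_(n in J) ~` B (x_ n)).
Proof.
move=> FG.
pose big (k : nat) (C : set T) x := (k.+1%:R^-1%:E <= mu (B x `&` C))%E.
pose good n (Cs : seq (set T)) x := G n x /\
  forall C, List.In C Cs -> forall k, (k <= n)%N -> F (big k C) -> big k C x.
have /choice[pick pickP] : forall nC : nat * seq (set T),
    exists x, good nC.1 nC.2 x.
  case=> n Cs; apply: (@filter_ex _ F); apply: filterI; first exact: FG.
  elim: Cs => [|C Cs IH]; first exact: nearW.
  have FC : F [set x | forall k : 'I_n.+1, F (big k C) -> big k C x].
    apply: filter_forall => k.
    have [Fk|nFk] := pselect (F (big k C)); first by apply: filterS Fk.
    by apply: nearW => x /nFk.
  apply: filterS2 FC IH => x xC xCs C' [<-|inC'] k kn; last exact: xCs.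
  by rewrite -ltnS in kn; exact: (xC (Ordinal kn)).
(* Cs n lists the intersections of complements of B (x_ i), for i in any subset
   of {0, ..., n - 1}. *)
pose Cs := fix Cs n := if n is m.+1 then
  Cs m ++ map (setI (~` B (pick (m, Cs m)))) (Cs m) else [:: setT].
pose x_ n := pick (n, Cs n).
have xP n : good n (Cs n) (x_ n) by exact: (pickP (n, Cs n)).
exists x_; split; first by move=> n; have [] := xP n.
move=> J Jinf.
pose CJ n := \bigcap_(i in [set i | (i < n)%N /\ J i]) ~` B (x_ i).
have CJin n : List.In (CJ n) (Cs n).
  elim: n => [|n IH] /=.
    by left; rewrite /CJ; apply/seteqP; split => // t _ i [].
  apply/List.in_or_app; have [Jn|Jn] := pselect (J n); [right|left].
    suff -> : CJ n.+1 = ~` B (x_ n) `&` CJ n by exact: List.in_map.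
    apply/seteqP; split => [t tC|t [nB tC] i [+ Ji]].
      split; first by apply: tC; split.
      by move=> i [i_n Ji]; apply: tC; split => //; exact: leqW.
    by rewrite ltnS leq_eqVlt => /predU1P[->//|i_n]; apply: tC.
  suff -> : CJ n.+1 = CJ n by [].
  apply/seteqP; split => [t tC i [i_n Ji]|t tC i [+ Ji]].
    by apply: tC; split => //; exact: leqW.
  rewrite ltnS leq_eqVlt => /predU1P[ni|i_n]; last exact: tC.
  by move: Ji; rewrite ni.
have mCJ n : measurable (CJ n).
  by apply: bigcap_measurableType => i _; exact: measurableC.
pose C := \bigcap_(n in J) ~` B (x_ n).
have mC : measurable C.
  by apply: bigcap_measurableType => i _; exact: measurableC.
exists C; first by split.
move=> a a0.
have [//|nF] := in_ultra_setVsetC [set x | (mu (B x `&` C) < a%:E)%E] FF.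
exfalso; have [k _ kP] := near_infty_natSinv_lt (PosNum a0).
have k0 : 0 < k.+1%:R^-1 :> R by rewrite invr_gt0.
have [|||N NP] := @measure_decreasing_to0 (fun n => CJ n `\` C) _ _ _ _ k0.
- by move=> n; exact: measurableD.
- move=> n m nm t [tm nC]; split => // i [i_n Ji]; apply: tm.
  by split => //; exact: leq_trans i_n nm.
- rewrite -subset0 => t tE; have [_ nC] := tE 0%N I; apply: nC => i Ji.
  by have [+ _] := tE i.+1 I; apply.
have [n Nn Jn] := Jinf (maxn N k).
have Fk : F (big k (CJ n)).
  apply: filterS nF => x /negP; rewrite -leNgt => ax.
  apply: (@le_trans _ _ a%:E).
    by rewrite lee_fin ltW//; exact: (kP k (leqnn k)).
  apply: (le_trans ax); apply: le_measure; rewrite ?inE; try exact: measurableI.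
  by apply: setIS => t tC i [_]; exact: tC.
have [_ /(_ _ (CJin n) k)] := xP n.
rewrite (leq_trans (leq_maxr _ _) Nn) => /(_ isT Fk); rewrite /big; apply/negP.
rewrite -ltNge; apply: le_lt_trans (NP n (leq_trans (leq_maxl _ _) Nn)).
apply: le_measure; rewrite ?inE; [exact: measurableI|exact: measurableD|].
by move=> t [Bt Ct]; split => // /(_ n Jn); apply.
Qed.

(** The infinite set J of available indices is thinned at each step. Almost all
    points lie in infinitely many of the [B (x_ n)] with n in J, so that [A j],
    which is not null, contains one. *)
Lemma branch_selection (x_ : nat -> L) (A : nat -> set T) :
  (forall J, infinitely_often J ->
    filter_null (\bigcap_(n in J) ~` B (x_ n))) ->
  (forall j, ~ filter_null (A j)) ->
  exists v : nat -> T, (forall j, A j (v j)) /\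
    forall j, infinitely_often [set n | forall i, (i <= j)%N -> B (x_ n) (v i)].
Proof.
move=> xJ nA.
have /choice[st stP] : forall jJ : nat * set nat, exists v,
    infinitely_often jJ.2 ->
    A jJ.1 v /\ infinitely_often (jJ.2 `&` [set n | B (x_ n) v]).
  case=> j J /=.
  have [Jinf|] := pselect (infinitely_often J); last by exists point.
  apply: contrapT => /forallNP nv; apply: (nA j).
  pose D N := \bigcap_(n in J `&` [set n | (N <= n)%N]) ~` B (x_ n).
  apply: (@filter_null_sub _ (\bigcup_N D N)); last first.
    apply: filter_null_bigcup => N; apply: xJ => N'.
    have [n nN Jn] := Jinf (maxn N N').
    exists n; first exact: leq_trans (leq_maxr _ _) nN.
    by split => //; exact: leq_trans (leq_maxl _ _) nN.
  move=> v Av; apply: contrapT => vD; apply: (nv v) => _; split => // N.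
  apply: contrapT => noN; apply: vD; exists N => // n [Jn Nn] Bn.
  by apply: noN; exists n.
pose Js := fix Js j := if j is i.+1 then
  Js i `&` [set n | B (x_ n) (st (i, Js i))] else [set: nat].
have Jinf j : infinitely_often (Js j).
  elim: j => [|j IH] /=; first by move=> N; exists N.
  by have [] := stP (j, Js j) IH.
exists (fun j => st (j, Js j)); split.
  by move=> j; have [] := stP (j, Js j) (Jinf j).
move=> j N; have [n Nn Jn] := Jinf j.+1 N; exists n => // i ij.
suff : Js i.+1 n by case.
elim: j ij Jn {Nn} => [|j IH]; first by rewrite leqn0 => /eqP->.
by rewrite leq_eqVlt => /predU1P[->//|ij] [+ _]; exact: IH.
Qed.

End filter_null_sets.

(** * Continuity in measure *)

Lemma cluster_seq_le (R : realType) (L : topologicalType) (z : nat -> L) (y : L)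
    (g : L -> R) c i : continuous g -> cluster (z @ \oo) y ->
  (forall j, (i <= j)%N -> g (z j) <= c) -> g y <= c.
Proof.
move=> gc yz gz; rewrite leNgt; apply/negP => cgy.
have ny : nbhs y [set u | c < g u] by exact: (cvgr_gt _ (gc y) _ cgy).
have nz : (z @ \oo) [set u | g u <= c] by exists i.
by have [u [/= uc]] := yz _ _ nz ny; apply/negP; rewrite -leNgt.
Qed.

Section continuity_in_measure.
Variables (R : realType) (V : topologicalType) (d : V -> V -> R).
Hypothesis dP : polish_dist d.
Variables (L : topologicalType) (M : metricType R) (e : L -> M -> R).
Hypothesis cL : compact [set: L].
Hypothesis e_cont : forall p, continuous (fun x => e x p).
Hypothesis e_inj : forall x y, (forall p, e x p = e y p) -> x = y.
Hypothesis e_baire : forall x, @baire1 R M (e x).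
Hypothesis cM : forall F : set_system M,
  ProperFilter F -> cauchy F -> exists p : M, F --> p.
Variable sm : nat -> M.
Hypothesis smP : forall p r, 0 < r -> exists n, ball (sm n) r p.

(** A countable base of the box topology. *)
Definition qbox k (c : seq nat * nat) : set (nat -> M) :=
  box k (fun i => sm (nth 0%N c.1 i)) c.2.+1%:R^-1.

Lemma qbox_near k w (r : R) : 0 < r ->
  exists2 c, qbox k c w & qbox k c `<=` box k w r.
Proof.
move=> r0; have r20 : 0 < r / 2 by exact: divr_gt0.
have [n _ /(_ n (leqnn n)) /= nr] := near_infty_natSinv_lt (PosNum r20).
have n0 : 0 < n.+1%:R^-1 :> R by rewrite invr_gt0.
have [a aP] := choice (fun p => smP p n0).
have wq : qbox k (mkseq (a \o w) k, n) w.
  by move=> i ik; rewrite /= nth_mkseq//; exact: aP.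
exists (mkseq (a \o w) k, n) => //.
move=> v vq.
apply: (box_half (v := fun i => sm (nth 0%N (mkseq (a \o w) k) i))).
  by apply/box_sym; apply: le_box wq; exact: ltW.
by apply: le_box vq; exact: ltW.
Qed.

Variables (dT : measure_display) (T : measurableType dT).
Variables (mu : {measure set T -> \bar R}) (phi : T -> L -> V).
Hypothesis mufin : (mu setT < +oo)%E.
Hypothesis phi_cont : forall t, continuous (phi t).
Hypothesis m_phi : forall x y c,
  measurable [set t | c <= d (phi t x) (phi t y)].

(** In the proof, u and v are two families of functions that share a code and
    whose tuples are dense in the same closed set W; a point y of L is found
    that u puts near x0 and v far from x0. *)
Lemma continuous_in_measure_seq (x0 : L) (eps : R) : 0 < eps ->
  \forall x \near x0,
    (mu [set t | (eps <= d (phi t x) (phi t x0))%R] < eps%:E)%E.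
Proof.
move=> eps0; apply: contrapT => not_near.
pose B x := [set t | eps <= d (phi t x) (phi t x0)].
have mB x : measurable (B x) by exact: m_phi.
pose far := [set x | (eps%:E <= mu (B x))%E].
have F0 : ProperFilter (within far (nbhs x0)).
  apply: Build_ProperFilter_ex => U xU; apply: contrapT => nU; apply: not_near.
  have {}xU : nbhs x0 [set x | far x -> U x] by exact: xU.
  apply: (filterS _ xU) => x Ux; rewrite ltNge; apply/negP => farx.
  by apply: nU; exists x; exact: Ux.
have [F [FF F0F]] := ultraFilterLemma F0.
have Ffar : F far by apply: F0F; exact: withinT.
have Fx0 U : nbhs x0 U -> F U.
  by move=> xU; apply: F0F; rewrite /within /=; apply: filterS xU => x Ux _.
have [s sP] := dist_separable dP.
have nT : ~ filter_null mu F B setT.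
  case=> C [mC TC] /(_ _ eps0) HC.
  have [x [/= + farx]] := @filter_ex _ F _ _ (filterI HC Ffar).
  have -> : B x `&` C = B x by apply: setIidl => t _; exact: TC.
  by apply/negP; rewrite -leNgt.
pose p0 := sm 0%N.
(* An error of eps / 8 occurs at y and at x0 for each of two functions: the
   total of eps / 2 is the gap between u and v. *)
have eps80 : 0 < eps / 8 by exact: divr_gt0.
pose Tc c := [set t | exists w, coded d e s (eps / 8) (phi t) w c].
have [c nTc] : exists c, ~ filter_null mu F B (Tc c).
  apply: contrapT => /forallNP nc; apply: nT.
  apply: (@filter_null_sub _ _ _ _ _ _ _ _ (\bigcup_c Tc c)).
    move=> t _.
    have [c [w cw]] := coded_ex dP cL e_cont e_inj sP p0 eps80 (@phi_cont t).
    by exists c => //; exists w.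
  by apply: filter_null_bigcup_count => // c; apply: contrapT; exact: nc.
have /choice[lam lamP] : forall t, exists w, Tc c t ->
    coded d e s (eps / 8) (phi t) w c.
  move=> t; have [[w tw]|nt] := pselect (Tc c t); first by exists w.
  by exists (fun=> p0).
pose k := c.1.1.
(* The support, in M^k, of the image under lam of the null ideal. *)
pose W : set (nat -> M) := [set w | forall r, 0 < r ->
  ~ filter_null mu F B (Tc c `&` [set t | box k w r (lam t)])].
have clW : box_closed k W.
  move=> w wW r r0 nw; have r20 : 0 < r / 2 by exact: divr_gt0.
  have [v Wv wv] := wW _ r20; apply: (Wv _ r20).
  by apply: filter_null_sub nw => t [ct vt]; split => //; exact: (box_half wv).
have nullW : filter_null mu F B (Tc c `&` [set t | ~ W (lam t)]).
  (* Lindelof: countably many boxes of the base, all null, cover ~` W. *)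
  pose N q := Tc c `&` [set t | qbox k q (lam t)] `&`
    [set t | filter_null mu F B (Tc c `&` [set t | qbox k q (lam t)])].
  apply: (@filter_null_sub _ _ _ _ _ _ _ _ (\bigcup_q N q)).
    move=> t [ct /= /existsNP[r /not_implyP[r0 /contrapT nr]]].
    have [q qt qr] := qbox_near k (lam t) r0; exists q => //; split => //=.
    by apply: filter_null_sub nr => u [cu qu]; split => //; exact: qr.
  apply: filter_null_bigcup_count => // q.
  have [nq|nq] := pselect
    (filter_null mu F B (Tc c `&` [set t | qbox k q (lam t)])).
    by apply: filter_null_sub nq => t [].
  by apply: filter_null_sub (filter_null0 mu B FF) => t [_ /nq].
pose TW := Tc c `&` [set t | W (lam t)].
have nTW : ~ filter_null mu F B TW.
  move=> nTW; apply: nTc.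
  apply: filter_null_sub (filter_nullU mufin FF mB nTW nullW) => t ct.
  by have [Wt|Wt] := pselect (W (lam t)); [left|right].
pose Sq q := TW `&` [set t | qbox k q (lam t)].
(* A j runs through the boxes of the base that meet W, with TW as a default
   value, so that no A j is null. *)
pose A j := if unpickle j is Some q then
  (if `[< filter_null mu F B (Sq q) >] then TW else Sq q) else TW.
have nA j : ~ filter_null mu F B (A j).
  by rewrite /A; case: unpickle => // q; case: asboolP.
have /choice[u uA] : forall j, exists t, A j t.
  move=> j; apply: contrapT => /forallNP nt; apply: (nA j).
  by apply: filter_null_sub (filter_null0 mu B FF) => t /nt.
pose G n := [set x |
  forall i : 'I_n.+1, d (phi (u i) x) (phi (u i) x0) <= eps / 2].
have FG n : F (G n).
  apply: Fx0; apply: filter_forall => i.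
  have cu : d (phi (u i) x) (phi (u i) x0) @[x --> x0] -->
      d (phi (u i) x0) (phi (u i) x0).
    by apply: (dist_cvg dP); [exact: phi_cont|exact: cvg_cst].
  rewrite (dist_refl dP) in cu.
  apply: filterS (cvgr_lt _ cu (eps / 2) _) => [x /ltW//|].
  by rewrite divr_gt0.
have [x_ [x_G x_J]] := filter_selection mufin FF mB FG.
have [v [vA vB]] := branch_selection mufin FF mB x_J nA.
have /choice[sg sgP] : forall j, exists n, (j <= n)%N /\
    forall i, (i <= j)%N -> B (x_ n) (v i).
  by move=> j; have [n jn nB] := vB j j; exists n.
have [y [_ y_cl]] : [set: L] `&` cluster ((x_ \o sg) @ \oo) !=set0.
  by apply: cL; exact: filterT.
have dc (f : L -> V) : continuous f -> continuous (fun x => d (f x) (f x0)).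
  by move=> fc x; apply: (dist_cvg dP); [exact: fc|exact: cvg_cst].
have yu i : d (phi (u i) y) (phi (u i) x0) <= eps / 2.
  apply: (cluster_seq_le (dc _ (@phi_cont (u i))) y_cl (i := i)) => j ij.
  have isg : (i < (sg j).+1)%N.
    by rewrite ltnS (leq_trans ij)//; have [] := sgP j.
  by have := x_G (sg j) (Ordinal isg).
have yv i : eps <= d (phi (v i) y) (phi (v i) x0).
  rewrite -lerN2.
  apply: (@cluster_seq_le R L _ y
    (fun x => - d (phi (v i) x) (phi (v i) x0)) _ i _ y_cl).
    by move=> x; apply: cvgN; exact: dc.
  by move=> j ij; rewrite lerN2; have [_] := sgP j; exact.
have [t0 [ct0 Wt0]] : TW !=set0.
  apply: contrapT => /forallNP nt; apply: nTW.
  by apply: filter_null_sub (filter_null0 mu B FF) => t /nt.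
have del0 : 0 < c.1.2.+1%:R^-1 :> R by rewrite invr_gt0.
have osc x i : (i < k)%N -> small_osc k W (fun w => e x (w i)).
  by move=> ik; apply: baire1_small_osc.
(* The values of y, and of x0, at each of the k points of a tuple hardly vary
   when the tuple stays in W, near w2. *)
have [w1 [r1 [Ww1 r10 _ osc1]]] :=
  small_osc_all (f := fun i w => e y (w i)) (osc y) Wt0 ltr01 del0.
have [w2 [r2 [Ww2 r20 w21 osc2]]] :=
  small_osc_all (f := fun i w => e x0 (w i)) (osc x0) Ww1 r10 del0.
have [q w2q qw2] := qbox_near k w2 r20.
have nSq : ~ filter_null mu F B (Sq q).
  move=> nq; have [r r0 rq] := box_open w2q.
  apply: (Ww2 r r0).
  apply: filter_null_sub (filter_nullU mufin FF mB nq nullW) => t [ct rt].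
  have [Wt|Wt] := pselect (W (lam t)); [left|right] => //.
  by split => //; exact: rq.
have AE : A (pickle q) = Sq q.
  by rewrite /A pickleK; case: asboolP.
have := uA (pickle q); have := vA (pickle q); rewrite AE.
set tv := v _; set tu := u _.
move=> [[cv Wv] qv] [[cu Wu] qu].
have vw2 := qw2 _ qv; have uw2 := qw2 _ qu.
have Hy := coded_close dP (lamP _ cu) (lamP _ cv)
  (fun i ik => osc1 i ik _ _ Wu Wv (w21 _ uw2) (w21 _ vw2)).
have Hx := coded_close dP (lamP _ cu) (lamP _ cv)
  (fun i ik => osc2 i ik _ _ Wu Wv uw2 vw2).
have := yu (pickle q); have := yv (pickle q); rewrite -/tv -/tu.
have := dist_tri dP (phi tu y) (phi tv y) (phi tv x0).
have := dist_tri dP (phi tu x0) (phi tu y) (phi tv x0).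
rewrite (dist_sym dP (phi tv y) (phi tu y)); lra.
Qed.

End continuity_in_measure.

Lemma dense_seq (R : realType) (M : metricType R) (S : set M) (p0 : M) :
  countable S -> dense S ->
  exists s : nat -> M, forall p r, 0 < r -> exists n, ball (s n) r p.
Proof.
move=> cS dS.
have near_S p r : 0 < r -> exists2 q, S q & ball q r p.
  move=> r0; have [||q [+ Sq]] := dS (ball p r)^°.
  - by exists p; exact: nbhsx_ballx.
  - exact: open_interior.
  by move=> /interior_subset pq; exists q => //; exact: ball_sym.
move: cS => /pfcard_geP[S0|[f]].
  by have [q] := near_S p0 1 ltr01; rewrite S0.
exists f => p r /(near_S p)[q Sq qp].
by have [n _ fn] := @surj _ _ _ _ f q Sq; exists n; rewrite fn.
Qed.

Theorem continuous_in_measure (R : realType) (V : topologicalType)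
    (d : V -> V -> R) (L : topologicalType) (M : metricType R)
    (e : L -> M -> R) (dT : measure_display) (T : measurableType dT)
    (mu : {measure set T -> \bar R}) (phi : T -> L -> V) (x0 : L) (eps : R) :
  polish_dist d -> compact [set: L] ->
  (forall p, continuous (fun x => e x p)) ->
  (forall x y, (forall p, e x p = e y p) -> x = y) ->
  (forall x, @baire1 R M (e x)) ->
  (forall F : set_system M,
    ProperFilter F -> cauchy F -> exists p : M, F --> p) ->
  (exists2 S : set M, countable S & dense S) ->
  (mu setT < +oo)%E -> (forall t, continuous (phi t)) ->
  (forall x y c, measurable [set t | c <= d (phi t x) (phi t y)]) ->
  0 < eps ->
  \forall x \near x0,
    (mu [set t | (eps <= d (phi t x) (phi t x0))%R] < eps%:E)%E.
Proof.
move=> dP cL e_cont e_inj e_baire cM [S cS dS] mufin phi_cont m_phi eps0.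
have [[p0]|noM] := pselect (inhabited M).
  have [sm smP] := dense_seq p0 cS dS.
  exact: (continuous_in_measure_seq dP cL e_cont e_inj e_baire cM smP).
(* If M is empty, then L has at most one point. *)
apply: nearW => x; rewrite (_ : [set t | _] = set0) ?measure0 ?lte_fin//.
rewrite -subset0 => t /=.
have -> : x = x0 by apply: e_inj => p; case: noM; exists.
by rewrite (dist_refl dP) leNgt eps0.
Qed.

(** * The space of continuous functions *)

Lemma ptws_cvg (U : Type) (V : topologicalType) (F : set_system (U -> V))
    (f : U -> V) : Filter F ->
  (forall u, g u @[g --> F] --> f u) -> {ptws, F --> f}.
Proof.
move=> FF Ff; apply/cvg_sup => u A [B [] [W oW WB] Bf BA].
apply: filterS BA _; rewrite -WB; apply: (Ff u W).
by apply: open_nbhs_nbhs; split => //; move: Bf; rewrite -WB.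
Qed.

Section Cp_topology.
Variables (K : numFieldType) (L : topologicalType).

Definition ev (f : Cp K L) : L -> K :=
  @set_val {ptws L -> K} (@continuous_fun K L) f.

Lemma ev_continuous f : continuous (ev f).
Proof. by have := set_mem (valP f). Qed.

Lemma ev_inj : injective ev.
Proof. by move=> f g; exact: val_inj. Qed.

Lemma ev_surj (f : L -> K) : continuous f -> exists g, ev g = f.
Proof.
move=> fc.
by exists (exist (fun f => f \in @continuous_fun K L) f (mem_set fc)).
Qed.

Lemma eval_continuous x : continuous (fun f => ev f x).
Proof.
move=> f; apply: (@continuous_comp (Cp K L) {ptws L -> K} K
  (@set_val _ (@continuous_fun K L)) (fun g => g x)).
  exact: initial_continuous.
exact: (@proj_continuous L (fun=> K) x).
Qed.

Lemma Cp_cvg (G : set_system (Cp K L)) (g : Cp K L) : Filter G ->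
  (forall x, ev f x @[f --> G] --> ev g x) -> G --> g.
Proof.
move=> FG Gg U [B [] [W oW WB] Bg BU].
have : {ptws, (ev @ G) --> ev g} by exact: ptws_cvg.
move=> /(_ W) H; apply: filterS BU _; rewrite -WB; apply: H.
by apply: open_nbhs_nbhs; split => //; move: Bg; rewrite -WB.
Qed.

End Cp_topology.

Lemma closed_continuous_le (R : realType) (T : topologicalType) (f : T -> R) c :
  continuous f -> closed [set t | f t <= c].
Proof.
move=> fc; apply: (@preimage_closed _ _ f [set r | r <= c]);
  last exact: closed_le.
by move=> t _; exact: fc.
Qed.

Lemma ultra_bigcup (T : Type) (G : set_system T) (H : nat -> set T) N :
  UltraFilter G -> G (\bigcup_(q < N) H q) -> exists q, G (H q).
Proof.
move=> FG; elim: N => [|N IH] GH.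
  by have [t [q]] := filter_ex GH.
have [GN|GN] := in_ultra_setVsetC (H N) FG; first by exists N.
apply: IH; apply: filterS2 GH GN => t [q /= + Hq] nHN.
by rewrite ltnS leq_eqVlt => /predU1P[qN|qN]; [rewrite qN in Hq|exists q].
Qed.

(** * Tightness *)

Section tightness.
Variables (R : realType) (K : numFieldType) (d : K -> K -> R).
Hypothesis dP : polish_dist d.
Variable L : topologicalType.
Hypothesis cL : compact [set: L].
Variable m : {outer_measure set (Cp K L) -> \bar R}.
Hypothesis mfin : (m setT < +oo)%E.
Hypothesis m_closed : forall A, closed A -> caratheodory_measurable m A.
Hypothesis m_tau : forall O : set (set (Cp K L)),
  (forall U, O U -> open U /\ m U = 0%E) -> m (\bigcup_(U in O) U) = 0%E.
Hypothesis m_cim : forall (x0 : L) (eps : R), 0 < eps -> \forall x \near x0,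
  (m [set f | (eps <= d (ev f x) (ev f x0))%R] < eps%:E)%E.

(** Basic entourages for convergence in measure, on L. *)
Definition entour (j : nat) (x y : L) :=
  (m [set f | (j.+1%:R^-1 <= d (ev f x) (ev f y))%R] < j.+1%:R^-1%:E)%E.

Lemma entourS i j x y : (i <= j)%N -> entour j x y -> entour i x y.
Proof.
move=> ij xy; have ji : j.+1%:R^-1 <= i.+1%:R^-1 :> R.
  by rewrite lef_pV2 ?posrE// ler_nat ltnS.
apply: (@lt_le_trans _ _ (j.+1%:R^-1)%:E); last by rewrite lee_fin.
by apply: le_lt_trans xy; apply: le_outer_measure => f /=; exact: le_trans.
Qed.

(** The complement of the support of m. *)
Definition null_open_union := \bigcup_(U in [set U | open U /\ m U = 0%E]) U.

(** If f x and f y differ, then so do g x and g y for all g near f, and these g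
    form a set of positive measure when f is in the support: x and y are not
    close in measure. Compactness turns this into a modulus of continuity. *)
Lemma entour_modulus (f : Cp K L) (eta : R) : ~ null_open_union f -> 0 < eta ->
  exists j, forall x y, entour j x y -> d (ev f x) (ev f y) <= eta.
Proof.
move=> nf eta0.
have [] := @compact_directed (L * L)%type nat 0%N maxn
  (fun j z => entour j z.1 z.2 -> d (ev f z.1) (ev f z.2) <= eta).
- by rewrite -setXTT; exact: compact_setX.
- by move=> i j z [] H ij; apply: H; apply: entourS ij;
    [exact: leq_maxl|exact: leq_maxr].
- move=> [x y]; have cxy : d (ev f z.1) (ev f z.2) @[z --> (x, y)] -->
      d (ev f x) (ev f y).
    apply: (dist_cvg dP).
      apply: (cvg_comp (@fst L L) (ev f)); first exact: cvg_fst.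
      exact: ev_continuous.
    apply: (cvg_comp (@snd L L) (ev f)); first exact: cvg_snd.
    exact: ev_continuous.
  have [dxy|dxy] := leP (d (ev f x) (ev f y)) 0.
    exists 0%N; apply: filterS (cvgr_lt _ cxy eta _) => [z /ltW//|].
    exact: le_lt_trans eta0.
  pose c := d (ev f x) (ev f y).
  pose O := [set g : Cp K L | c / 2 < d (ev g x) (ev g y)].
  have mO : m O != 0%E.
    apply/eqP => mO; apply: nf; exists O; last first.
      by rewrite /O /=; move: dxy; rewrite -/c; lra.
    split => //; rewrite (_ : O = ~` [set g | d (ev g x) (ev g y) <= c / 2]).
      rewrite openC; apply: closed_continuous_le; apply: (dist_continuous dP);
        exact: eval_continuous.
    by apply/funext => g; apply/propext; rewrite /O /= ltNge; split => /negP.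
  have mO_fin : m O \is a fin_num.
    rewrite ge0_fin_numE ?outer_measure_ge0//.
    by apply: le_lt_trans mfin; exact: le_outer_measure.
  have mO0 : 0 < fine (m O).
    rewrite fine_gt0// lt0e mO outer_measure_ge0.
    by rewrite -ge0_fin_numE ?outer_measure_ge0.
  (* Three times del: moving x, moving y, and the distance in measure of the
     moved points. *)
  have [del [del0 delc delm]] : exists del : R, [/\ 0 < del, 3 * del <= c / 2 &
      3 * del <= fine (m O)].
    exists (Num.min (c / 6) (fine (m O) / 3)); split.
    - by rewrite lt_min !divr_gt0.
    - apply: (@le_trans _ _ (3 * (c / 6))); last by lra.
      by rewrite ler_pM2l// ge_min lexx.
    - apply: (@le_trans _ _ (3 * (fine (m O) / 3))); last by lra.
      by rewrite ler_pM2l// ge_min lexx orbT.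
  have [j _ /(_ j (leqnn j)) /= jdel] := near_infty_natSinv_lt (PosNum del0).
  exists j.
  have nx : \forall z \near (x, y),
      (m [set g | (del <= d (ev g z.1) (ev g x))%R] < del%:E)%E.
    by apply: (cvg_fst (m_cim x del0)).
  have ny : \forall z \near (x, y),
      (m [set g | (del <= d (ev g z.2) (ev g y))%R] < del%:E)%E.
    by apply: (cvg_snd (m_cim y del0)).
  apply: filterS2 nx ny => -[x' y'] /= hx hy hj; exfalso.
  have : (m O < (3 * del)%:E)%E.
    pose A := [set g | (del <= d (ev g x') (ev g x))%R].
    pose B := [set g | (del <= d (ev g y') (ev g y))%R].
    pose C := [set g | (j.+1%:R^-1 <= d (ev g x') (ev g y'))%R].
    apply: (@le_lt_trans _ _ (m A + m B + m C)%E).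
      apply: (@le_trans _ _ (m (A `|` B) + m C)%E); last first.
        by apply: leeD2r; exact: outer_measureU2.
      apply: (@le_trans _ _ (m (A `|` B `|` C))); last exact: outer_measureU2.
      apply: le_outer_measure => g /= Og.
      apply: contrapT => /not_orP[/not_orP[]] /negP + /negP + /negP.
      rewrite -!ltNge => ga gb /lt_trans/(_ jdel) gc.
      have := dist_tri dP (ev g x') (ev g x) (ev g y).
      have := dist_tri dP (ev g y') (ev g x') (ev g y).
      move: Og; rewrite /O /= (dist_sym dP (ev g x) (ev g x')); lra.
    have -> : 3 * del = del + del + del by lra.
    rewrite !EFinD; apply: lteD; first exact: lteD.
    by apply: lt_trans hj _; rewrite lte_fin.
  by rewrite -(fineK mO_fin) lte_fin ltNge delm.
- by move=> j jP; exists j => x y; exact: (jP (x, y)).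
Qed.

Lemma entour_net j : exists xs : seq L,
  forall x, exists2 x', x' \in xs & entour j x x'.
Proof.
apply: (@compact_directed L (seq L) [::] (@cat _)
  (fun xs x => exists2 x', x' \in xs & entour j x x')) => //.
- by move=> s t x [] [y ys xy]; exists y => //; rewrite mem_cat ys ?orbT.
- move=> x; exists [:: x]; have j0 : 0 < j.+1%:R^-1 :> R by rewrite invr_gt0.
  by apply: filterS (m_cim x j0) => y xy; exists x => //; exact: mem_head.
Qed.

(** Separability for the sup norm: up to 4 * eta, a function with modulus j is
    known from rough values on a finite net for the j-th entourage. *)
Lemma small_cells_cover (eta : R) : 0 < eta -> exists H : nat -> set (Cp K L),
  [/\ forall q, closed (H q), ~` null_open_union `<=` \bigcup_q H q &
   forall q f g, H q f -> H q g -> forall x, d (ev f x) (ev g x) <= 4 * eta].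
Proof.
move=> eta0; have [s sP] := dist_separable dP.
have /choice[xs xsP] := entour_net.
pose H0 (q : nat * seq nat) := [set f : Cp K L |
  (forall x, x \in xs q.1 ->
    d (ev f x) (s (nth 0%N q.2 (index x (xs q.1)))) <= eta) /\
  (forall x y, entour q.1 x y -> d (ev f x) (ev f y) <= eta)].
exists (fun n => if unpickle n is Some q then H0 q else set0); split.
- move=> n; case: unpickle => [[j r]|]; last exact: closed0.
  rewrite (_ : H0 _ =
    \bigcap_(x in [set x | x \in xs j])
      [set f | d (ev f x) (s (nth 0%N r (index x (xs j)))) <= eta] `&`
    \bigcap_(z in [set z | entour j z.1 z.2])
      [set f | d (ev f z.1) (ev f z.2) <= eta]).
    apply: closedI; apply: closed_bigI => z _; apply: closed_continuous_le;
      apply: (dist_continuous dP); try exact: eval_continuous.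
    exact: cst_continuous.
  apply/seteqP; split => f [fs fd]; first by split => // -[x y]; exact: fd.
  by split => // x y xy; exact: (fd (x, y)).
- move=> f nf; have [j jP] := entour_modulus nf eta0.
  have [a aP] := choice (fun x => sP (ev f x) eta eta0).
  exists (pickle (j, map a (xs j))) => //; rewrite pickleK; split => //= x xxs.
  rewrite (nth_map x) ?index_mem// nth_index//; exact/ltW.
- move=> n f g; case: unpickle => [[j r]|]//= [/= fs fd] [/= gs gd] x.
  have [x' x'xs xx'] := xsP j x.
  have := fs _ x'xs; have := gs _ x'xs; have := fd _ _ xx'; have := gd _ _ xx'.
  set c := s _ => h1 h2 h3 h4.
  have := dist_tri dP (ev f x') (ev f x) (ev g x).
  have := dist_tri dP c (ev f x') (ev g x).
  have := dist_tri dP (ev g x') c (ev g x).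
  rewrite (dist_sym dP c (ev g x')) (dist_sym dP (ev g x') (ev g x)); lra.
Qed.

Lemma null_open_union0 : m null_open_union = 0%E.
Proof. by apply: m_tau => U. Qed.

Lemma almost_covered (eta a : R) : 0 < eta -> 0 < a ->
  exists (H : nat -> set (Cp K L)) (N : nat), [/\ forall q, closed (H q),
   (m (~` \bigcup_(q < N) H q) < a%:E)%E &
   forall q f g, H q f -> H q g -> forall x, d (ev f x) (ev g x) <= 4 * eta].
Proof.
move=> eta0 a0; have [H [Hc Hcov Hd]] := small_cells_cover eta0.
pose D n := \bigcup_(q < n) H q.
pose mm : {measure set (caratheodory_type m) -> \bar R} := m.
have mH q : measurable (H q : set (caratheodory_type m)) by apply: m_closed.
have mD n : measurable (D n : set (caratheodory_type m)).
  exact: bigcup_measurable.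
have mDD n : measurable (\bigcup_q H q `\` D n : set (caratheodory_type m)).
  by apply: measurableD => //; exact: bigcupT_measurable.
have [||N NP] := @measure_decreasing_to0 R _ _ mm mfin
  (fun n => \bigcup_q H q `\` D n) a mDD _ _ a0.
- move=> n k nk f [Hf nD]; split => // -[q /= qn Hq]; apply: nD.
  by exists q => //=; exact: leq_trans qn nk.
- rewrite -subset0 => f fE; have [[q _ Hq] _] := fE 0%N I.
  by have [_] := fE q.+1 I; apply; exists q => //=.
exists H, N; split => //.
apply: le_lt_trans (NP N (leqnn N)).
apply: (@le_trans _ _ (m null_open_union + m (\bigcup_q H q `\` D N))%E);
  last by rewrite null_open_union0 add0e.
apply: le_trans (outer_measureU2 _ _ _); apply: le_outer_measure => f nf.
by have [Uf|/Hcov Hf] := pselect (null_open_union f); [left|right; split].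
Qed.

(** Ulam's argument. An ultrafilter on the intersection of the sets [D n] is
    Cauchy for the uniform distance, so that its pointwise limit is
    continuous. *)
Theorem Cp_tight (a : R) : 0 < a -> exists C : set (Cp K L),
  compact C /\ (m (~` C) <= a%:E)%E.
Proof.
move=> a0.
have step n : exists HN : (nat -> set (Cp K L)) * nat,
   [/\ forall q, closed (HN.1 q),
   (m (~` \bigcup_(q < HN.2) HN.1 q) < (a / (2 ^ n.+1)%:R)%:E)%E &
   forall q f g, HN.1 q f -> HN.1 q g ->
     forall x, d (ev f x) (ev g x) <= 4 * n.+1%:R^-1].
  have [||H [N HN]] := @almost_covered n.+1%:R^-1 (a / (2 ^ n.+1)%:R).
  - by rewrite invr_gt0.
  - by rewrite divr_gt0// ltr0n expn_gt0.
  - by exists (H, N).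
have [HN HNP] := choice step.
pose D n := \bigcup_(q < (HN n).2) (HN n).1 q.
have clD n : closed (D n).
  by apply: closed_bigcup => // q _; have [] := HNP n.
exists (\bigcap_n D n); split; last first.
  rewrite setC_bigcap; apply: le_trans (outer_measure_sigma_subadditive m _) _.
  have := @epsilon_trick R (fun=> 0%E) a xpredT (fun=> lexx _) (ltW a0).
  rewrite [X in (_ <= X + _)%E]eseries0// add0e => Ha; apply: le_trans Ha.
  apply: lee_nneseries => [n _ _|n _]; first exact: outer_measure_ge0.
  by rewrite add0e; have [_ /ltW] := HNP n.
rewrite compact_ultra => G FG GD /=.
have GD' n : G (D n) by apply: filterS GD => f; exact.
have G_small n : exists f0,
    G [set f | forall x, d (ev f0 x) (ev f x) <= 4 * n.+1%:R^-1].
  have [q Gq] := ultra_bigcup FG (GD' n).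
  have [f0 Hf0] := filter_ex Gq; exists f0.
  by apply: filterS Gq => f Hf; have [_ _ Hd] := HNP n; exact: Hd Hf0 Hf.
have small (eps : R) : 0 < eps -> exists n, 4 * n.+1%:R^-1 < eps.
  move=> eps0; have eps40 : 0 < eps / 4 by exact: divr_gt0.
  have [n _ /(_ n (leqnn n)) /= ne] := near_infty_natSinv_lt (PosNum eps40).
  by exists n; rewrite mulrC -ltr_pdivlMr.
have lim_ex x : exists l : K, ev f x @[f --> G] --> l.
  have FGx : ProperFilter ((fun f => ev f x) @ G) by exact: fmap_proper_filter.
  have [|l lx] := dist_complete dP FGx; last by exists l.
  move=> eps /small[n ne].
  have [f0 Gf0] := G_small n; exists (ev f0 x).
  have : G [set f | d (ev f0 x) (ev f x) < eps]; last by [].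
  by apply: (filterS _ Gf0) => f Hf /=; exact: le_lt_trans (Hf x) ne.
have [l lP] := choice lim_ex.
have l_near (eps : R) : 0 < eps ->
    exists f0, forall x, d (ev f0 x) (l x) <= eps.
  move=> /small[n ne]; have [f0 Gf0] := G_small n; exists f0 => x.
  apply: le_trans (ltW ne).
  have cd : d (ev f0 x) (ev f x) @[f --> G] --> d (ev f0 x) (l x).
    by apply: (dist_cvg dP); [exact: cvg_cst|exact: lP].
  apply: (@closed_cvg _ _ G _ _ [set r : R | r <= 4 * n.+1%:R^-1]) cd.
    exact: closed_le.
  by apply: filterS Gf0 => f; exact.
have l_cont : continuous l.
  move=> x; apply/(dist_cvgP dP) => eps eps0.
  have eps30 : 0 < eps / 3 by exact: divr_gt0.
  have [f0 f0l] := l_near _ eps30.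
  have cf0 : ev f0 y @[y --> x] --> ev f0 x by exact: ev_continuous.
  have /(dist_cvgP dP)/(_ _ eps30) := cf0.
  apply: filterS => y xy; have := f0l x; have := f0l y.
  have := dist_tri dP (ev f0 x) (l x) (l y).
  have := dist_tri dP (ev f0 y) (ev f0 x) (l y).
  rewrite (dist_sym dP (l x) (ev f0 x)); lra.
have [g gl] := ev_surj l_cont.
have Gg : G --> g by apply: Cp_cvg => x; rewrite gl; exact: lP.
exists g; split => // n _.
exact: (closed_cvg (D n) (clD n) (GD' n) _ Gg).
Qed.

End tightness.

(** * The scalar fields *)

Lemma real_polish_dist (R : realType) : polish_dist (fun x y : R => `|x - y|).
Proof.
split.
- by move=> x; rewrite subrr normr0.
- exact: distrC.
- by move=> y x z; exact: ler_distD.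
- move=> x U; split=> [/nbhs_ballP[e /= e0 eU]|[e e0 eU]]; first by exists e.
  by apply/nbhs_ballP; exists e.
- exists (fun n => if unpickle n is Some q then ratr q else 0) => x e e0.
  have [|q] := @rat_in_itvoo R (x - e) (x + e); first by lra.
  rewrite in_itv /= => /andP[q1 q2]; exists (pickle q); rewrite pickleK.
  by rewrite ltr_norml; apply/andP; split; lra.
- move=> F FF Fc.
  have /cauchy_cvgP : cauchy F by exact: cauchy_exP.
  by move=> ?; exists (lim F).
Qed.

Lemma complex_polish_dist (R : realType) :
  @polish_dist R (R[i] : numFieldType) (fun x y : R[i] => Normc.normc (x - y)).
Proof.
have normEc (z : R[i]) : `|z| = (Normc.normc z)%:C%C by [].
have normc_le (z : R[i]) : Normc.normc z <= `|complex.Re z| + `|complex.Im z|.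
  case: z => a b /=.
  rewrite -(ger0_norm (addr_ge0 (normr_ge0 a) (normr_ge0 b))).
  rewrite -sqrtr_sqr ler_sqrt ?sqr_ge0// sqrrD !real_normK ?num_real//.
  by rewrite addrAC lerDl mulrn_wge0// mulr_ge0.
have Re_le (z : R[i]) : `|complex.Re z| <= Normc.normc z.
  by case: z => a b /=; rewrite -sqrtr_sqr ler_wsqrtr// lerDl sqr_ge0.
have Im_le (z : R[i]) : `|complex.Im z| <= Normc.normc z.
  by case: z => a b /=; rewrite -sqrtr_sqr ler_wsqrtr// lerDr sqr_ge0.
split.
- by move=> x; rewrite subrr Normc.normc0.
- by move=> x y; rewrite -normcN opprB.
- move=> y x z; have -> : x - z = (x - y) + (y - z) by rewrite addrA subrK.
  exact: le_normcD.
- move=> x U; split=> [/nbhs_ballP[e /= e0 eU]|[e e0 eU]].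
    exists (complex.Re e); first by move: e0; rewrite ltcE => /andP[].
    move=> y /= xy; apply: eU; rewrite /ball /= normEc ltcE /= xy andbT.
    by move: e0; rewrite ltcE => /andP[/eqP-> _].
  apply/nbhs_ballP; exists e%:C%C; first by rewrite /= ltcR.
  by move=> y; rewrite /ball /= normEc ltcR => /eU.
- pose q2 (q : rat * rat) : R[i] := (ratr q.1 +i* ratr q.2)%C.
  exists (fun n => if unpickle n is Some q then q2 q else 0) => x e e0.
  have [|q] := @rat_in_itvoo R (complex.Re x - e / 2) (complex.Re x + e / 2).
    by lra.
  have [|r] := @rat_in_itvoo R (complex.Im x - e / 2) (complex.Im x + e / 2).
    by lra.
  rewrite !in_itv /= => /andP[r1 r2] /andP[q1 q2'].
  exists (pickle (q, r)); rewrite pickleK; apply: le_lt_trans (normc_le _) _.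
  case: x q1 q2' r1 r2 => a b /= *.
  have h1 : `|a - ratr q| < e / 2 by rewrite ltr_norml; apply/andP; split; lra.
  have h2 : `|b - ratr r| < e / 2 by rewrite ltr_norml; apply/andP; split; lra.
  by lra.
- move=> F FF Fc.
  have part (p : R[i] -> R) :
      (forall z w, `|p z - p w| <= Normc.normc (z - w)) ->
      exists l : R, forall e, 0 < e -> \forall z \near F, `|l - p z| < e.
    move=> ple; have FFp : ProperFilter (p @ F) by exact: fmap_proper_filter.
    have /cauchy_cvgP cp : cauchy (p @ F).
      apply: cauchy_exP => e /Fc[x Fx]; exists (p x).
      have : F [set y | `|p x - p y| < e]; last by [].
      by apply: filterS Fx => y; exact: le_lt_trans.
    exists (lim (p @ F)) => e e0.
    have /cvgrPdist_lt/(_ _ e0) : p z @[z --> F] --> lim (p @ F) by exact: cp.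
    by [].
  have [|a aP] := part (@complex.Re R).
    by move=> z w; rewrite -raddfB; exact: Re_le.
  have [|b bP] := part (@complex.Im R).
    by move=> z w; rewrite -raddfB; exact: Im_le.
  exists (a +i* b)%C => U /nbhs_ballP[e /= e0 eU].
  have [e1 e10 eE] : exists2 r : R, 0 < r & e = r%:C%C.
    case: e e0 {eU} => r s; rewrite ltcE /= => /andP[/eqP-> r0].
    by exists r.
  have e20 : 0 < e1 / 2 by exact: divr_gt0.
  change (F U); apply: filterS2 (aP _ e20) (bP _ e20) => -[x y] /= ax bY.
  apply: eU; rewrite eE /ball /= normEc ltcR.
  apply: le_lt_trans (normc_le _) _ => /=.
  by move: ax bY; lra.
Qed.

(** * Measures on the Stone-Cech compactification *)

Lemma mu_ext_negligible (R : realType) (dT : measure_display)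
    (T : measurableType dT) (mu : {measure set T -> \bar R}) (N : set T) :
  mu_ext mu N = 0%E -> mu.-negligible N.
Proof.
move=> N0.
have cover n : exists Z : set T, [/\ measurable Z, N `<=` Z &
    (mu Z <= n.+1%:R^-1%:E)%E].
  have n0 : 0 < n.+1%:R^-1 :> R by rewrite invr_gt0.
  have [|_ [A [mA NA] <-]] := lb_ereal_inf_adherent n0
      (S := [set (\sum_(k <oo) mu (A k))%E | A in measurable_cover N]).
    by rewrite -/(mu_ext mu N) N0.
  rewrite -/(mu_ext mu N) N0 add0e => /ltW An.
  exists (\bigcup_k A k); split => //.
    exact: bigcupT_measurable.
  apply: le_trans An; apply: measure_sigma_subadditive => //.
  exact: bigcupT_measurable.
have [Z ZP] := choice cover.
have mZ : measurable (\bigcap_n Z n).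
  by apply: bigcapT_measurable => n; have [] := ZP n.
exists (\bigcap_n Z n); split => //; last first.
  by move=> t Nt n _; have [_ + _] := ZP n; exact.
apply/eqP; rewrite eq_le measure_ge0 andbT; apply/lee_addgt0Pr => e e0.
rewrite add0e.
have [n _ /(_ n (leqnn n)) /= ne] := near_infty_natSinv_lt (PosNum e0).
apply: (@le_trans _ _ (mu (Z n))).
  have [mZn _ _] := ZP n.
  by apply: le_measure; rewrite ?inE//; exact: bigcap_inf.
by have [_ _ /le_trans] := ZP n; apply; rewrite lee_fin ltW.
Qed.

Section stone_cech_theory.
Variables (R : realType) (X : ptopologicalType).
Local Notation beta := (stone_cech R X).
Local Notation unit_ := (@stone_cech_unit R X).

Lemma stone_cech_val_continuous (f : @unit_interval_fun R X) :
  continuous (fun p : beta => set_val p f).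
Proof.
move=> p; apply: (@continuous_comp beta {ptws (@unit_interval_fun R X) -> R} R
  (@set_val _ (closure (range (@stone_cech_eval R X)))) (fun g => g f)).
  exact: initial_continuous.
exact: (@proj_continuous (@unit_interval_fun R X) (fun=> R) f).
Qed.

Lemma stone_cech_hausdorff : hausdorff_space beta.
Proof.
move=> p q pq; apply: val_inj; apply/funext => f; apply: (@Rhausdorff R).
move=> A B pA qB.
have [r [Ar Br]] := pq _ _ (@stone_cech_val_continuous f p A pA)
  (@stone_cech_val_continuous f q B qB).
by exists (set_val r f).
Qed.

Lemma stone_cech_unit_continuous : continuous unit_.
Proof.
move=> x U [B [] [W oW WB] Bx BU].
pose ev0 (y : X) : @unit_interval_fun R X -> R := @stone_cech_eval R X y.
have H : {ptws, (ev0 @ x) --> ev0 x}.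
  apply: ptws_cvg => f; have [fc _] := set_mem (valP f); exact: fc.
apply: filterS BU _; rewrite -WB; apply: (H W).
by apply: open_nbhs_nbhs; split => //; move: Bx; rewrite -WB.
Qed.

Hypothesis crX : completely_regular_space X.

(** By complete regularity, a function to [0, 1] that vanishes at x and equals 1
    off O, seen as a coordinate of the cube, provides a neighbourhood of x. *)
Lemma stone_cech_unit_open (O : set X) : open O ->
  exists2 O' : set beta, open O' & unit_ @^-1` O' = O.
Proof.
move=> oO.
exists (\bigcup_(U in [set U : set beta | open U /\ unit_ @^-1` U `<=` O]) U).
  by apply: bigcup_open => U [].
apply/seteqP; split => [x [U [_ UO] /UO//]|x Ox].
have [f [fc f01 fx fO]] := (@uniform_separatorP _ R _ _).1
  (crX (open_closedC oO) (fun n => n Ox)).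
have fP : f \in @unit_interval_fun R X.
  apply/mem_set; split => // y; have /f01 : range f (f y) by exists y.
  by rewrite /= in_itv.
pose F : @unit_interval_fun R X := exist _ f fP.
exists [set p : beta | set_val p F < 1].
  split.
    apply: (open_comp (f := fun p : beta => set_val p F)
      (D := [set r | r < 1])).
      by move=> p _; exact: stone_cech_val_continuous.
    exact: open_lt.
  move=> y /= fy; apply: contrapT => nO.
  have : f y < 1 by exact: fy.
  have -> : f y = 1 by apply: fO; exists y.
  by rewrite ltxx.
have : f x < 1; last by [].
by have -> : f x = 0 by apply: fx; exists x.
Qed.

Variable lambda : {finite_measure set (borelType beta) -> \bar R}.

Definition trace_outer (A : set X) : \bar R :=
  mu_ext lambda (unit_ @` A : set (borelType beta)).

Lemma trace_outer0 : trace_outer set0 = 0%E.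
Proof. by rewrite /trace_outer image_set0 outer_measure0. Qed.

Lemma trace_outer_ge0 A : (0 <= trace_outer A)%E.
Proof. exact: outer_measure_ge0. Qed.

Lemma le_trace_outer : {homo trace_outer : A B / A `<=` B >-> (A <= B)%E}.
Proof. by move=> A B AB; apply: le_outer_measure; exact: image_subset. Qed.

Lemma trace_outer_sigma_subadditive : sigma_subadditive trace_outer.
Proof.
move=> F; rewrite /trace_outer image_bigcup.
exact: outer_measure_sigma_subadditive.
Qed.

HB.instance Definition _ := isOuterMeasure.Build R X trace_outer trace_outer0
  trace_outer_ge0 le_trace_outer trace_outer_sigma_subadditive.

Lemma trace_outer_fin : (trace_outer setT < +oo)%E.
Proof.
apply: (@le_lt_trans _ _ (lambda setT)); last first.
  exact: fin_num_fun_lty (fin_num_measure lambda).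
by rewrite -measurable_mu_extE//; exact: le_outer_measure.
Qed.

Lemma open_borel (U : set beta) :
  open U -> measurable (U : set (borelType beta)).
Proof. by move=> oU; exact: sub_sigma_algebra. Qed.

Lemma trace_outer_closed A : closed A -> caratheodory_measurable trace_outer A.
Proof.
move=> cA; have [W' oW W'A] := stone_cech_unit_open (closed_openC cA) => Y.
have WE y : W' (unit_ y) <-> ~ A y.
  by have : (unit_ @^-1` W') y <-> (~` A) y by rewrite W'A.
have := caratheodory_measurable_mu_ext lambda (measurableC (open_borel oW)).
move=> /(_ (unit_ @` Y)); rewrite /trace_outer => ->.
congr (_ + _)%E; congr (mu_ext lambda _).
  apply/seteqP; split => [_ [[y Yy <-] nW]|_ [y [Yy Ay] <-]].
    by exists y => //; split => //; apply: contrapT => /WE.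
  by split; [exists y|move=> /WE].
rewrite setCK; apply/seteqP; split => [_ [[y Yy <-] /WE nA]|_ [y [Yy nA] <-]].
  by exists y.
by split; [exists y|apply/WE].
Qed.

Hypothesis lambda_radon : radon lambda.

(** Let G be the union of the open sets of the compactification with trace in
    O. A compact subset C of G is covered by finitely many of them, so that its
    trace is null; and as lambda is Radon, C can be chosen with G minus C of
    small measure. *)
Lemma trace_outer_tau (O : set (set X)) :
  (forall U, O U -> open U /\ trace_outer U = 0%E) ->
  trace_outer (\bigcup_(U in O) U) = 0%E.
Proof.
move=> OP.
pose D := [set U : set beta | open U /\ O (unit_ @^-1` U)].
pose G := \bigcup_(U in D) U.
have oG : open G by apply: bigcup_open => U [].
have mG := open_borel oG.
have OG : unit_ @` (\bigcup_(U in O) U) `<=` G.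
  move=> _ [x [U OU Ux] <-]; have [oU _] := OP U OU.
  have [U' oU' U'U] := stone_cech_unit_open oU.
  exists U'; first by split => //; rewrite U'U.
  by rewrite -[U' _]/((unit_ @^-1` U') x) U'U.
have compact_null (C : set beta) : compact C -> C `<=` G ->
    mu_ext lambda (range unit_ `&` C : set (borelType beta)) = 0%E.
  move=> cC CG; apply: contrapT => nC.
  (* The sets A that contain almost all of the trace of C form a filter. A
     cluster point p in C belongs to some U in D, while ~` U is in the
     filter. *)
  pose F := [set A : set beta |
    mu_ext lambda (range unit_ `&` C `\` A : set (borelType beta)) = 0%E].
  have F_sub (A B : set beta) :
      mu_ext lambda (B : set (borelType beta)) = 0%E -> A `<=` B ->
      mu_ext lambda (A : set (borelType beta)) = 0%E.
    move=> B0 AB; apply/eqP; rewrite eq_le outer_measure_ge0 andbT -B0.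
    exact: le_outer_measure.
  have FF : ProperFilter F.
    split; first by move=> F0; apply: nC; rewrite -[_ `&` C]setD0.
    split.
    - by rewrite /F /= setDT outer_measure0.
    - move=> A B FA FB; rewrite /F /= setDIr; apply/eqP.
      rewrite eq_le outer_measure_ge0 andbT.
      by apply: le_trans (outer_measureU2 _ _ _) _; rewrite /= FA FB adde0.
    - by move=> A B AB FA; apply: F_sub FA _; exact: setDS.
  have [p [Cp Fp]] : C `&` cluster F !=set0.
    by apply: cC; apply: F_sub (outer_measure0 _) _ => q [[]].
  have [U [oU OU] Up] := CG p Cp.
  have FU : F (~` U).
    have [_ U0] := OP _ OU; apply: F_sub U0 _ => q [[[x _ <-] _]].
    by move=> /contrapT Ux; exists x.
  by have [q [] //] := Fp _ _ FU (open_nbhs_nbhs (conj oU Up)).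
apply/eqP; rewrite eq_le outer_measure_ge0 andbT; apply/lee_addgt0Pr => e e0.
rewrite add0e.
have Gfin : lambda G \is a fin_num by exact: fin_num_measure.
have [|_ [C [cC CG] <-] GC] := ub_ereal_sup_adherent e0
  (S := [set lambda C | C in [set C : set beta | compact C /\ C `<=` G]]).
  by rewrite -lambda_radon.
rewrite -lambda_radon// in GC.
have mC : measurable (C : set (borelType beta)).
  rewrite -[C]setCK; apply: measurableC; apply: open_borel.
  apply: closed_openC; apply: compact_closed => //.
  exact: stone_cech_hausdorff.
apply: (@le_trans _ _
    (mu_ext lambda (range unit_ `&` C : set (borelType beta)) +
    mu_ext lambda (G `\` C : set (borelType beta)))%E).
  apply: le_trans (outer_measureU2 _ _ _); apply: le_outer_measure => p Op.
  have [Cp|nCp] := pselect (C p); [left|right; split => //; exact: OG].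
  by split => //; case: Op => x _ <-; exists x.
rewrite compact_null// add0e measurable_mu_extE; last exact: measurableD.
rewrite measureD//; last by rewrite -ge0_fin_numE.
rewrite (setIidr CG) leeBlDr//; last by rewrite fin_num_measure.
by move/ltW: GC; rewrite leeBlDr// addeC.
Qed.

End stone_cech_theory.

Section universally_measurable_of_tight.
Variables (R : realType) (X : ptopologicalType).

(** The points of X outside all the compact sets [C n] lie, for each n, in a set
    of outer measure at most 1 / (n + 1). *)
Theorem universally_measurable_of_tight :
  completely_regular_space X -> hausdorff_space X ->
  (forall m : {outer_measure set X -> \bar R},
    (m setT < +oo)%E ->
    (forall A, closed A -> caratheodory_measurable m A) ->
    (forall O : set (set X), (forall U, O U -> open U /\ m U = 0%E) ->
      m (\bigcup_(U in O) U) = 0%E) ->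
    forall a : R, 0 < a -> exists C, compact C /\ (m (~` C) <= a%:E)%E) ->
  universally_measurable R X.
Proof.
move=> crX hX tightX; split => // lambda lambda_radon.
pose m : {outer_measure set X -> \bar R} := trace_outer lambda.
have tight_m := tightX m (trace_outer_fin lambda)
  (trace_outer_closed crX lambda) (trace_outer_tau crX lambda_radon).
have [C CP] := choice (fun n => tight_m n.+1%:R^-1 ltac:(by rewrite invr_gt0)).
pose B : set (borelType (stone_cech R X)) :=
  \bigcup_n (@stone_cech_unit R X @` C n).
exists B.
  apply: bigcupT_measurable => n; rewrite -[_ @` _]setCK; apply: measurableC.
  apply: open_borel; apply: closed_openC; apply: compact_closed.
    exact: stone_cech_hausdorff.
  apply: continuous_compact; last by have [] := CP n.
  exact/continuous_subspaceT/stone_cech_unit_continuous.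
exists (range (@stone_cech_unit R X) `\` B); last first.
  apply/seteqP; split => [p [[n _ [x _ <-]]|[]//]|p xp]; first by exists x.
  by have [Bp|nBp] := pselect (B p); [left|right].
apply: mu_ext_negligible; apply/eqP; rewrite eq_le outer_measure_ge0 andbT.
apply/lee_addgt0Pr => e e0; rewrite add0e.
have [n _ /(_ n (leqnn n)) /= ne] := near_infty_natSinv_lt (PosNum e0).
have [_ Cn] := CP n.
apply: (@le_trans _ _ n.+1%:R^-1%:E); last by rewrite lee_fin ltW.
apply: le_trans Cn; apply: le_outer_measure => p [[x _ <-] nB].
exists x => // Cx; apply: nB; exists n => //; exists x => //.
Qed.

End universally_measurable_of_tight.

(** * Rosenthal compact sets *)

Section rosenthal.
Variables (R : realType) (L : topologicalType).
Variables (K : numFieldType) (d : K -> K -> R).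
Hypothesis dP : polish_dist d.

Lemma Cp_completely_regular : completely_regular_space (Cp K L).
Proof.
exact: (@uniform_completely_regular R (set_type (@continuous_fun K L))).
Qed.

Lemma Cp_hausdorff : hausdorff_space (Cp K L).
Proof.
move=> f g fg; apply: ev_inj; apply/funext => x.
apply: (@norm_hausdorff K K^o) => A B fA gB.
have [h [Ah Bh]] := fg _ _ (@eval_continuous K L x f A fA)
  (@eval_continuous K L x g B gB).
by exists (ev h x).
Qed.

Lemma rosenthal_embedding : rosenthal_compact R L ->
  compact [set: L] /\ exists (M : metricType R) (e : L -> M -> R),
  [/\ forall p, continuous (fun x => e x p),
      forall x y, (forall p, e x p = e y p) -> x = y,
      forall x, @baire1 R M (e x),
      forall F : set_system M,
        ProperFilter F -> cauchy F -> exists p : M, F --> p &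
      exists2 S : set M, countable S & dense S].
Proof.
move=> [cL _ [P [[M [[f [g [_ gc fK _]]] cM sepM]] [A AB]]]].
move=> [h [h' [hc _ hK _]]].
split => //; exists M, (fun x p => set_val (h x) (g p)); split => //.
- move=> p; move=> x.
  apply: (@continuous_comp L {ptws P -> R} R (fun x => set_val (h x))
    (fun u => u (g p))).
    apply: (@continuous_comp L A {ptws P -> R} h (@set_val _ A)).
      exact: hc.
    exact: initial_continuous.
  exact: (@proj_continuous P (fun=> R) (g p)).
- move=> x y exy; rewrite -[x]hK -[y]hK; congr h'; apply: val_inj.
  by apply/funext => p; rewrite -[p]fK; exact: exy.
- move=> x; have [u uc ux] := AB _ (set_mem (valP (h x))).
  exists (fun n => u n \o g); last by move=> p; exact: ux.
  by move=> n p; apply: continuous_comp; [exact: gc|exact: uc].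
Qed.

Theorem Cp_universally_measurable : rosenthal_compact R L ->
  universally_measurable R (Cp K L).
Proof.
move=> /rosenthal_embedding[cL [M [e [e_cont e_inj e_baire cM sepM]]]].
apply: universally_measurable_of_tight;
  [exact: Cp_completely_regular|exact: Cp_hausdorff|].
move=> m mfin m_closed m_tau a a0.
apply: (Cp_tight dP cL mfin m_closed m_tau _ a0).
move=> x0 eps eps0.
pose mm : {measure set (caratheodory_type m) -> \bar R} := m.
apply: (@continuous_in_measure R K d L M e _ _ mm (@ev K L) x0 eps) => //.
  exact: ev_continuous.
move=> x y c; apply: m_closed.
apply: (@preimage_closed _ _ (fun f : Cp K L => d (ev f x) (ev f y))
  [set r | c <= r]).
  by move=> f _; apply: (dist_continuous dP); exact: eval_continuous.
exact: closed_ge.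
Qed.
End rosenthal.

Theorem proposition15 (R : realType) (L : topologicalType) :
  rosenthal_compact R L ->
  universally_measurable R (Cp R L) /\ universally_measurable R (Cp R[i] L).
Proof.
move=> rL; split.
  exact: (Cp_universally_measurable (real_polish_dist R) rL).
exact: (Cp_universally_measurable (complex_polish_dist R) rL).
Qed.
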